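(* Let $G=\mathrm O(M)$ (types $B_n$, $D_n$) or $G=\mathrm{Sp}(M)$ (type $C_n$) over $\mathbb F_q$, consider its parabolic contraction determined by a symmetric partition of the index set into segments, and let $\mathbb G^a$ act on $\mathfrak u^a$ by $g\bullet X=gXg^\dagger$. Then: 1) Each $\mathbb G^a$-orbit in $\mathfrak u^a$ contains an element of the form $\mathcal X_{D,\phi}$ for some basic pair $(D,\phi)$ in $\Delta(\mathfrak u^a)$. 2) For basic pairs $(D,\phi)$ and $(\tilde D,\tilde\phi)$ in $\Delta(\mathfrak u^a)$, the elements $\mathcal X_{D,\phi}$ and $\mathcal X_{\tilde D,\tilde\phi}$ belong to a common $\mathbb G^a$-orbit if and only if $(D,\phi)$ and $(\tilde D,\tilde\phi)$ belong to a common $W_{\mathbb L}$-orbit.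
   Context: $\mathbb F_q$ is a finite field of characteristic $\ne2$, $\delta\in\mathbb F_q^*$ a fixed non-square. $M=2n+1$ for type $B_n$, $M=2n$ for types $C_n,D_n$. Rows and columns of $M\times M$ matrices are indexed, in decreasing order, by $I=\{n,\dots,1,0,-1,\dots,-n\}$ for $B_n$ and by $I=\{n,\dots,1,-1,\dots,-n\}$ for $C_n,D_n$. Let $\mathbb I_m$ be the $m\times m$ matrix with ones on the antidiagonal and zeros elsewhere, $\mathbb J_{2n}=\begin{pmatrix}0&\mathbb I_n\\-\mathbb I_n&0\end{pmatrix}$. Put $X^\dagger=\mathbb I_MX^t\mathbb I_M$ for $B_n,D_n$ and $X^\dagger=\mathbb J_{2n}X^t\mathbb J_{2n}^{-1}$ for $C_n$; $G=\{g\in\mathrm{GL}(M,\mathbb F_q): g^\dagger=g^{-1}\}$ is $\mathrm O(M)$, resp. $\mathrm{Sp}(M)$. Fix a partition of $I$ into consecutive segments $I_\ell,\dots,I_0,\dots,I_{-\ell}$ (listed in decreasing order) with $I_{-k}=-I_k$ ($I_0$ may be empty for $C_n,D_n$). Let $\mathfrak P$ be the algebra of block upper triangular matrices (the $I_k\times I_m$ block vanishes for $k<m$), $\mathcal U_+$ the strictly block upper triangular matrices, $\mathbb L$ the group of invertible block diagonal matrices, and $\mathcal U_-^a=\mathcal U_+^*$, identified with the strictly block lower triangular matrices via $\lambda(x)=\mathrm{Tr}(\lambda x)$. The associative algebra $\mathfrak P\oplus\mathcal U_-^a$ has matrix multiplication on $\mathfrak P$, zero multiplication on $\mathcal U_-^a$,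 and $(t\lambda)(x)=\lambda(xt)$, $(\lambda t)(x)=\lambda(tx)$ for $t\in\mathfrak P$, $\lambda\in\mathcal U_-^a$, $x\in\mathcal U_+$. $\mathbb G^a$ is its group of invertible elements; $\mathcal U^a=\mathcal U_+\oplus\mathcal U_-^a$. The map $\dagger$ (matrix $\dagger$ on each summand) is an involutive antiautomorphism of this algebra. The parabolic contraction of $G$ is $G^a=\{g\in\mathbb G^a: g^\dagger=g^{-1}\}$, and $\mathfrak u^a=\{X\in\mathcal U^a: X^\dagger=-X\}$. Roots of $G$ are represented by pairs in $I\times I$: $\epsilon_i-\epsilon_j$ ($i>j>0$) by $(i,j)$, $\epsilon_i+\epsilon_j$ ($i>j>0$) by $(i,-j)$, $\epsilon_i$ by $(i,0)$ (type $B_n$), $2\epsilon_i$ by $(i,-i)$ (type $C_n$), $i>0$; the negative of a root is represented by the transposed pair. Thus roots are the pairs $(i,j)$ with $i\ne j$, $i+j>0$, and in type $C_n$ also all $(i,-i)$ (anti-diagonal roots). For $\alpha=(i,j)$ put $\alpha'=(-j,-i)$. $\Delta(\mathfrak u^a)$ is the set of roots lying in blocks $I_k\times I_m$ with $k\neq m$; such a root is positive if $k>m$ and negative if $k<m$. To a positive (negative) root attach $\mathcal E_\alpha=E_\alpha+\eta(\alpha)E_{\alpha'}\in\mathfrak u^a$ (resp. $\mathcal F_\alpha=F_\alpha+\eta(\alpha)F_{\alpha'}\in\mathfrak u^a$), where $E,F$ are matrix units in $\mathcal U_+$, $\mathcal U_-^a$, $\eta(\alpha)=0$ if $\alpha=\alpha'$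 and otherwise $\eta(\alpha)\in\{\pm1\}$ is the sign for which the element lies in $\mathfrak u^a$. A subset $D$ of roots is a rook placement if $D\cup D'$, $D'=\{\alpha':\alpha\in D\}$, has at most one pair in each row and each column; $D_\pm$ is the set of positive/negative roots in $D$. For $\phi:D\to\mathbb F_q^*$ put $\mathcal X_{D,\phi}=\sum_{\gamma\in D_+}\phi(\gamma)\mathcal E_\gamma+\sum_{\gamma\in D_-}\phi(\gamma)\mathcal F_\gamma$. A basic pair in $\Delta(\mathfrak u^a)$ is $(D,\phi)$ with $D\subset\Delta(\mathfrak u^a)$ a rook placement and: in types $B_n,D_n$, $\phi\equiv1$; in type $C_n$, (1) $\phi(\gamma)\in\{1,\delta\}$, (2) $\phi(\gamma)=\delta$ implies $\gamma$ is anti-diagonal, (3) for each $k$, $D\cap(I_k\times I_{-k})$ is contained in the anti-diagonal and $\phi=\delta$ on at most one root of this subset. $W_{\mathbb L}=\prod_kS_{I_k}$ is the Weyl group of $\mathbb L$, acting on pairs by $w\cdot(i,j)=(w(i),-w(-j))$. It acts on basic pairs: $w\bullet(D,\phi)=(D_1,\phi_1)$, where $D_1$ is the rook placement with $D_1\cup D_1'=w\cdot(D\cup D')$, $\phi_1(w\cdot\gamma)=\phi(\gamma)$ for anti-diagonal $\gamma\in D$, and $\phi_1=1$ on all other roots of $D_1$. *)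

(* Defs.v *)
From HB Require Import structures.
From mathcomp Require Import all_boot all_order fingroup perm all_algebra.
From mathcomp Require Import zify ring.

Set Implicit Arguments.
Unset Strict Implicit.
Unset Printing Implicit Defensive.

Import Order.TTheory GRing.Theory Num.Theory.
Local Open Scope ring_scope.

Inductive classical_type := TypeB | TypeC | TypeD.

Definition is_typeC (t : classical_type) : bool :=
  if t is TypeC then true else false.

Definition msize (t : classical_type) (n : nat) : nat :=
  if t is TypeB then (n + n).+1 else (n + n)%N.

(* Rows and columns are ordinals p = 0, 1, ...; label p is the element of I
   that p stands for, i.e. n, ..., 1, 0, -1, ..., -n in type B and
   n, ..., 1, -1, ..., -n in types C, D. The negation of I is rev_ord
   (see label_rev_ord). *)
Definition label (t : classical_type) (n : nat) (p : 'I_(msize t n)) : int :=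
  if (if t is TypeB then true else (p < n)%N) then n%:Z - p%:Z
  else n%:Z - p%:Z - 1.

Definition antidiag_mx (F : fieldType) (m : nat) : 'M[F]_m :=
  \matrix_(i, j) (j == rev_ord i)%:R.

Definition symp_mx (F : fieldType) (n : nat) : 'M[F]_(n + n) :=
  block_mx 0 (antidiag_mx F n) (- antidiag_mx F n) 0.

Definition dagger (F : fieldType) (t : classical_type) (n : nat) :
    'M[F]_(msize t n) -> 'M[F]_(msize t n) :=
  match t return 'M[F]_(msize t n) -> 'M[F]_(msize t n) with
  | TypeC => fun X => symp_mx F n *m X^T *m invmx (symp_mx F n)
  | TypeB | TypeD => fun X => antidiag_mx F _ *m X^T *m antidiag_mx F _
  end.

Section Partition.
Variables (t : classical_type) (n : nat).
Implicit Type blk : 'I_(msize t n) -> int.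

(* The partition of I into segments is encoded by the function sending an
   element of I_k to k. Only I_0 may be empty. *)
Definition symmetric_segments (l : nat) blk : Prop :=
  [/\ forall i j, label i <= label j -> blk i <= blk j,
      forall i, blk (rev_ord i) = - blk i,
      forall i, `|blk i| <= l%:Z
    & forall k : int, k != 0 -> `|k| <= l%:Z -> exists i, blk i = k].

End Partition.

Section Contraction.
Variables (F : fieldType) (t : classical_type) (n : nat).
Local Notation m := (msize t n).
Variable blk : 'I_m -> int.
Implicit Types A N : 'M[F]_m.
Implicit Types g h X Y : 'M[F]_m * 'M[F]_m.

Definition block_upper A : Prop :=
  forall i j, blk i < blk j -> A i j = 0.
Definition strict_upper A : Prop :=
  forall i j, blk i <= blk j -> A i j = 0.
Definition strict_lower A : Prop :=
  forall i j, blk j <= blk i -> A i j = 0.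

Definition lower_part A : 'M[F]_m :=
  \matrix_(i, j) (if blk i < blk j then A i j else 0).

(* The two actions of the block upper triangular algebra P on U_-^a = U_+^*, in terms of the strictly lower
   matrix that represents a linear form via the trace pairing; see
   dual_actlP, dual_actrP and trace_pairing_inj. *)
Definition dual_actl A N := lower_part (A *m N).
Definition dual_actr N A := lower_part (N *m A).

(* An element of P (+) U_-^a is a pair of matrices satisfying in_alg. *)
Definition in_alg g : Prop := block_upper g.1 /\ strict_lower g.2.

Definition alg_mul g h : 'M[F]_m * 'M[F]_m :=
  (g.1 *m h.1, dual_actl g.1 h.2 + dual_actr g.2 h.1).

Definition alg_one : 'M[F]_m * 'M[F]_m := (1%:M, 0).

Definition alg_dagger g : 'M[F]_m * 'M[F]_m := (dagger g.1, dagger g.2).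

(* The group of invertible elements of the whole algebra, not the parabolic
   contraction of G inside it. *)
Definition in_Ga g : Prop :=
  in_alg g /\
  exists h, [/\ in_alg h, alg_mul g h = alg_one & alg_mul h g = alg_one].

Definition in_Ua X : Prop := strict_upper X.1 /\ strict_lower X.2.

Definition in_ua X : Prop := in_Ua X /\ alg_dagger X = - X.

Definition Ga_act g X : 'M[F]_m * 'M[F]_m := alg_mul (alg_mul g X) (alg_dagger g).

Definition same_Ga_orbit X Y : Prop := exists g, in_Ga g /\ Y = Ga_act g X.

End Contraction.

Section Roots.
Variables (t : classical_type) (n : nat).
Local Notation m := (msize t n).
Implicit Types (a : 'I_m * 'I_m) (D : {set 'I_m * 'I_m}).

Definition twin a : 'I_m * 'I_m := (rev_ord a.2, rev_ord a.1).

Definition antidiag a : bool := a.2 == rev_ord a.1.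

Definition is_root a : bool :=
  (a.1 != a.2) && (0 < label a.1 + label a.2) || is_typeC t && antidiag a.

Definition twins D : {set 'I_m * 'I_m} := [set twin a | a in D].

Definition rook_placement D : Prop :=
  {in D, forall a, is_root a} /\
  {in D :|: twins D &, forall a b,
     (a.1 = b.1 -> a = b) /\ (a.2 = b.2 -> a = b)}.

Variable blk : 'I_m -> int.

Definition root_ua a : bool := is_root a && (blk a.1 != blk a.2).

Definition pos_part D : {set 'I_m * 'I_m} := [set a in D | blk a.2 < blk a.1].
Definition neg_part D : {set 'I_m * 'I_m} := [set a in D | blk a.1 < blk a.2].

Definition Weyl_L : {set 'S_m} := [set w : 'S_m | [forall i, blk (w i) == blk i]].

Definition Weyl_pair (w : 'S_m) a : 'I_m * 'I_m :=
  (w a.1, rev_ord (w (rev_ord a.2))).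

Variable F : fieldType.
Implicit Type phi : 'I_m * 'I_m -> F.

Definition elem_mx a : 'M[F]_m := delta_mx a.1 a.2.

Definition eta a : F :=
  if a == twin a then 0
  else let S := elem_mx a + elem_mx (twin a) in
       if dagger S == - S then 1 else -1.

Definition root_mx a : 'M[F]_m := elem_mx a + eta a *: elem_mx (twin a).

Definition root_E a : 'M[F]_m * 'M[F]_m := (root_mx a, 0).
Definition root_F a : 'M[F]_m * 'M[F]_m := (0, root_mx a).

(* A map D -> F_q^* is encoded by a total function phi of which only the
   values on D are ever used. *)
Definition calX D phi : 'M[F]_m * 'M[F]_m :=
  \sum_(a in pos_part D) phi a *: root_E a +
  \sum_(a in neg_part D) phi a *: root_F a.

Definition basic_pair (delta : F) D phi : Prop :=
  [/\ {in D, forall a, root_ua a}, rook_placement D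
    & if is_typeC t then
        [/\ {in D, forall a, phi a = 1 \/ phi a = delta},
            {in D, forall a, phi a = delta -> antidiag a}
          & forall k : int,
              {in D, forall a, blk a.1 = k -> blk a.2 = - k -> antidiag a} /\
              (#|[set a in D | [&& blk a.1 == k, blk a.2 == - k
                                 & phi a == delta]]| <= 1)%N]
      else {in D, forall a, phi a = 1}].

(* (D1, phi1) = w . (D, phi). *)
Definition Weyl_act_rel (w : 'S_m) D phi (D1 : {set 'I_m * 'I_m})
    (phi1 : 'I_m * 'I_m -> F) : Prop :=
  [/\ rook_placement D1,
      D1 :|: twins D1 = [set Weyl_pair w a | a in D :|: twins D],
      {in D, forall a, antidiag a -> phi1 (Weyl_pair w a) = phi a}
    & {in D1, forall b, b \notin [set Weyl_pair w a | a in D & antidiag a] ->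
                        phi1 b = 1}].

Definition same_Weyl_orbit D phi D1 phi1 : Prop :=
  exists w, w \in Weyl_L /\ Weyl_act_rel w D phi D1 phi1.

End Roots.

(* The remainder of the file checks that the encodings above are the intended
   objects. *)

Section Labels.
Variables (F : fieldType) (t : classical_type) (n : nat).
Local Notation m := (msize t n).

Lemma label_rev_ord (p : 'I_m) : label (rev_ord p) = - label p.
Proof.
rewrite /label; case: t p => p; have := ltn_ord p; rewrite /= => pm; first lia.
- by case: ltnP => ?; case: ltnP => ?; lia.
- by case: ltnP => ?; case: ltnP => ?; lia.
Qed.

Lemma label_inj : injective (@label t n).
Proof.
move=> p q e; apply: val_inj; move: e; rewrite /label.
case: t p q => p q; have := ltn_ord p; have := ltn_ord q; rewrite /= => qm pm.
- lia.
- by case: ltnP => ?; case: ltnP => ?; lia.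
- by case: ltnP => ?; case: ltnP => ?; lia.
Qed.

(* The sign of the row p in antidiag_mx, resp. symp_mx. *)
Definition row_sign (p : 'I_m) : F :=
  if is_typeC t && (n <= p)%N then -1 else 1.

Lemma row_sign_sq p : row_sign p * row_sign p = 1.
Proof. by rewrite /row_sign; case: ifP; rewrite ?mulrNN mul1r. Qed.

End Labels.

Lemma symp_mxE (F : fieldType) n (i j : 'I_(n + n)) :
  symp_mx F n i j = (j == rev_ord i)%:R * @row_sign F TypeC n i.
Proof.
rewrite /symp_mx /row_sign /= -[i]splitK -[j]splitK.
case: (split i) => i'; case: (split j) => j' /=.
- rewrite block_mxEul mxE; case: eqP => [/(congr1 val)|]; last by rewrite mul0r.
  by move=> /=; have := ltn_ord i'; have := ltn_ord j'; lia.
- rewrite block_mxEur mxE leqNgt ltn_ord /= mulr1; congr (_%:R).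
  congr (nat_of_bool _); apply/eqP/eqP => /(congr1 val) /= e; apply: val_inj => /=;
  by move: e; have := ltn_ord i'; have := ltn_ord j'; lia.
- rewrite block_mxEdl !mxE leq_addr mulrN1; congr (- (_%:R)).
  congr (nat_of_bool _); apply/eqP/eqP => /(congr1 val) /= e; apply: val_inj => /=;
  by move: e; have := ltn_ord i'; have := ltn_ord j'; lia.
- rewrite block_mxEdr mxE; case: eqP => [/(congr1 val)|]; last by rewrite mul0r.
  by move=> /=; have := ltn_ord i'; have := ltn_ord j'; lia.
Qed.

Lemma antidiag_mulE (F : fieldType) m (X : 'M[F]_m) i j :
  (antidiag_mx F m *m X *m antidiag_mx F m) i j = X (rev_ord i) (rev_ord j).
Proof.
rewrite mxE (bigD1 (rev_ord j)) //= big1 => [|k /negPf kj].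
  rewrite mxE (bigD1 (rev_ord i)) //= big1 => [|k /negPf ki].
    by rewrite !mxE rev_ordK !eqxx !addr0 mulr1 mul1r.
  by rewrite mxE ki mul0r.
by rewrite [X in _ * X]mxE -(can_eq (@rev_ordK m)) rev_ordK eq_sym kj mulr0.
Qed.

Lemma symp_mulV (F : fieldType) n : symp_mx F n *m (symp_mx F n)^T = 1%:M.
Proof.
apply/matrixP => i j; rewrite mxE (bigD1 (rev_ord i)) //= big1 => [|k /negPf ki].
  rewrite [_^T _ _]mxE !symp_mxE eqxx mul1r (inj_eq rev_ord_inj) mxE addr0.
  by case: eqP => [->|]; rewrite ?mul0r ?mulr0 // mul1r row_sign_sq.
by rewrite symp_mxE ki !mul0r.
Qed.

Lemma symp_mxV (F : fieldType) n : invmx (symp_mx F n) = (symp_mx F n)^T.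
Proof.
have [_ u] := mulmx1_unit (symp_mulV F n); rewrite unitmx_tr in u.
by rewrite -[LHS]mulmx1 -(symp_mulV F n) mulKmx.
Qed.

Section Checks.
Variables (F : fieldType) (t : classical_type) (n : nat).
Local Notation m := (msize t n).
Variable blk : 'I_m -> int.
Local Notation rs := (@row_sign F t n).
Implicit Types A B N P : 'M[F]_m.
Implicit Types g h k : 'M[F]_m * 'M[F]_m.

Lemma daggerE A i j :
  dagger A i j = rs i * rs j * A (rev_ord j) (rev_ord i).
Proof.
rewrite /dagger; case: t A i j => A i j.
- by rewrite antidiag_mulE mxE !mul1r.
- rewrite symp_mxV mxE (bigD1 (rev_ord j)) //= big1 => [|p /negPf pj].
    rewrite [_^T _ _]mxE symp_mxE eqxx mul1r addr0 mxE (bigD1 (rev_ord i)) //=.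
    rewrite big1 => [|p /negPf pi]; last by rewrite symp_mxE pi !mul0r.
    by rewrite symp_mxE eqxx mul1r addr0 mxE -mulrA [A _ _ * _]mulrC mulrA.
  by rewrite [_^T _ _]mxE symp_mxE pj mul0r mulr0.
- by rewrite antidiag_mulE mxE !mul1r.
Qed.

Lemma row_sign_rev i :
  rs (rev_ord i) = (if is_typeC t then -1 else 1) * rs i.
Proof.
rewrite /row_sign; case: t i => i /=; rewrite ?mul1r //.
have := ltn_ord i; rewrite /= => i_lt.
have -> : (n <= n + n - i.+1)%N = ~~ (n <= i)%N by lia.
by case: (n <= i)%N; rewrite mulN1r ?opprK.
Qed.

Lemma daggerK : involutive (@dagger F t n).
Proof.
move=> A; apply/matrixP => i j; rewrite !daggerE !rev_ordK !row_sign_rev.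
set c := if _ then _ else _; have cc : c * c = 1.
  by rewrite /c; case: ifP; rewrite ?mulrNN mul1r.
have si : rs i * rs i = 1 by exact: row_sign_sq.
have sj : rs j * rs j = 1 by exact: row_sign_sq.
transitivity (c * c * (rs i * rs i)
              * (rs j * rs j) * A i j); first by ring.
by rewrite cc si sj !mul1r.
Qed.

Lemma dagger_mul A B : dagger (A *m B) = dagger B *m dagger A.
Proof.
apply/matrixP => i j; rewrite daggerE !mxE mulr_sumr.
rewrite (reindex_inj rev_ord_inj) /=; apply: eq_bigr => p _; rewrite !daggerE.
have sp : rs p * rs p = 1 by exact: row_sign_sq.
transitivity (rs p * rs p * (rs i * rs j *
  (A (rev_ord j) (rev_ord p) * B (rev_ord p) (rev_ord i)))); last by ring.
by rewrite sp mul1r.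
Qed.

Lemma daggerD A B : dagger (A + B) = dagger A + dagger B.
Proof. by apply/matrixP => i j; rewrite mxE !daggerE mxE mulrDr. Qed.

Lemma daggerZ (c : F) A : dagger (c *: A) = c *: dagger A.
Proof. by apply/matrixP => i j; rewrite mxE !daggerE mxE; ring. Qed.

Lemma lower_part_strict A : strict_lower blk (lower_part blk A).
Proof. by move=> i j ij; rewrite mxE ltNge ij. Qed.

Lemma lower_part_id N : strict_lower blk N -> lower_part blk N = N.
Proof.
by move=> Nl; apply/matrixP => i j; rewrite mxE; case: ltP => // /Nl ->.
Qed.

(* A strictly upper matrix only sees the strictly lower part in the trace
   pairing. *)
Lemma mxtrace_lower_part A P :
  strict_upper blk P -> \tr (lower_part blk A *m P) = \tr (A *m P).
Proof.
move=> Pu; apply: eq_bigr => i _; rewrite !mxE; apply: eq_bigr => j _.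
by rewrite mxE; case: ltP => // /Pu ->; rewrite !mulr0.
Qed.

Lemma dual_actlP A N P : strict_upper blk P ->
  \tr (dual_actl blk A N *m P) = \tr (N *m (P *m A)).
Proof.
by move=> Pu; rewrite mxtrace_lower_part // -mulmxA mxtrace_mulC mulmxA.
Qed.

Lemma dual_actrP A N P : strict_upper blk P ->
  \tr (dual_actr blk N A *m P) = \tr (N *m (A *m P)).
Proof. by move=> Pu; rewrite mxtrace_lower_part // mulmxA. Qed.

Lemma trace_pairing_inj N (N' : 'M[F]_m) :
  strict_lower blk N -> strict_lower blk N' ->
  (forall P, strict_upper blk P -> \tr (N *m P) = \tr (N' *m P)) -> N = N'.
Proof.
have trE (A : 'M[F]_m) i j : \tr (A *m delta_mx j i) = A i j.
  rewrite /mxtrace (bigD1 i) //= big1 => [|k /negPf ki].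
    rewrite addr0 mxE (bigD1 j) //= big1 => [|k /negPf kj].
      by rewrite mxE !eqxx mulr1 addr0.
    by rewrite mxE kj mulr0.
  by rewrite mxE big1 // => p _; rewrite mxE ki andbF mulr0.
move=> Nl Nl' e; apply/matrixP => i j; have [ij|ij] := ltP (blk i) (blk j).
  rewrite -!trE; apply: e => p q; rewrite mxE; case: eqP => // -> /=.
  by case: eqP => // ->; rewrite leNgt ij.
by rewrite Nl ?Nl'.
Qed.

Lemma lower_part_mulr A N : block_upper blk A ->
  lower_part blk (A *m lower_part blk N) = lower_part blk (A *m N).
Proof.
move=> Au; apply/matrixP => i j; rewrite !mxE; case: ifP => // ij.
apply: eq_bigr => p _; rewrite mxE; have [ip|pi] := ltP (blk i) (blk p).
  by rewrite Au // !mul0r.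
by rewrite (le_lt_trans pi ij).
Qed.

Lemma lower_part_mull A N : block_upper blk A ->
  lower_part blk (lower_part blk N *m A) = lower_part blk (N *m A).
Proof.
move=> Au; apply/matrixP => i j; rewrite !mxE; case: ifP => // ij.
apply: eq_bigr => p _; rewrite mxE; have [pj|jp] := ltP (blk p) (blk j).
  by rewrite Au // !mulr0.
by rewrite (lt_le_trans ij jp).
Qed.

Lemma lower_partD A B :
  lower_part blk (A + B) = lower_part blk A + lower_part blk B.
Proof.
by apply/matrixP => i j; rewrite !mxE; case: ifP; rewrite ?addr0.
Qed.

Lemma in_alg_mul g h :
  in_alg blk g -> in_alg blk h -> in_alg blk (alg_mul blk g h).
Proof.
move=> [gu gl] [hu hl]; split=> /= i j ij; rewrite mxE.
  apply: big1 => p _; have [ip|pi] := ltP (blk i) (blk p).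
    by rewrite gu // mul0r.
  by rewrite hu ?mulr0 // (le_lt_trans pi ij).
by rewrite !lower_part_strict // addr0.
Qed.

Lemma alg_mulA g h k : in_alg blk g -> in_alg blk h -> in_alg blk k ->
  alg_mul blk g (alg_mul blk h k) = alg_mul blk (alg_mul blk g h) k.
Proof.
move=> [gu _] _ [ku _]; rewrite /alg_mul /=; congr (_, _).
  by rewrite mulmxA.
rewrite /dual_actl /dual_actr mulmxDr mulmxDl !lower_partD.
by rewrite !lower_part_mulr // !lower_part_mull // !mulmxA addrA.
Qed.

Lemma alg_mul1 g : in_alg blk g -> alg_mul blk g (alg_one F t n) = g.
Proof.
move=> [_ gl]; rewrite /alg_mul /dual_actl /dual_actr /= mulmx0 !mulmx1.
rewrite -lower_partD add0r lower_part_id //.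
by case: g gl.
Qed.

Lemma alg_mul1l g : in_alg blk g -> alg_mul blk (alg_one F t n) g = g.
Proof.
move=> [_ gl]; rewrite /alg_mul /dual_actl /dual_actr /= mul0mx !mul1mx.
rewrite -lower_partD addr0 lower_part_id //.
by case: g gl.
Qed.

Hypothesis blkN : forall i, blk (rev_ord i) = - blk i.

Lemma dagger_lower_part A :
  dagger (lower_part blk A) = lower_part blk (dagger A).
Proof.
apply/matrixP => i j; rewrite daggerE !mxE daggerE !blkN ltrN2.
by case: ifP; rewrite ?mulr0.
Qed.

Lemma in_alg_dagger g : in_alg blk g -> in_alg blk (alg_dagger g).
Proof.
move=> [gu gl]; split=> /= i j ij; rewrite daggerE.
  by rewrite gu ?mulr0 // !blkN ltrN2.
by rewrite gl ?mulr0 // !blkN lerN2.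
Qed.

Lemma alg_daggerM g h :
  alg_dagger (alg_mul blk g h) = alg_mul blk (alg_dagger h) (alg_dagger g).
Proof.
rewrite /alg_dagger /alg_mul /dual_actl /dual_actr /= daggerD dagger_mul.
by rewrite !dagger_lower_part !dagger_mul addrC.
Qed.

Lemma dagger_elem_mx (a : 'I_m * 'I_m) : dagger (elem_mx F a) =
  (rs a.1 * rs a.2) *: elem_mx F (twin a).
Proof.
apply/matrixP => i j; rewrite daggerE /elem_mx !mxE /=.
rewrite -!(can2_eq (@rev_ordK m) (@rev_ordK m)).
case: eqP => [<-|_]; last by rewrite andbF !mulr0.
case: eqP => [<-|_]; last by rewrite !mulr0.
rewrite !row_sign_rev; case: ifP => _; ring.
Qed.

Lemma root_mx_skew (a : 'I_m * 'I_m) :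
  is_root a -> dagger (root_mx F a) = - root_mx F a.
Proof.
move=> ra; rewrite /root_mx /eta; set E := elem_mx F a; set E' := elem_mx F _.
have := dagger_elem_mx a; have := dagger_elem_mx (twin a).
rewrite -/E -/E' /twin /= !rev_ordK -surjective_pairing -/E !row_sign_rev.
set c := if is_typeC t then -1 else 1 : F => dE' dE.
have cc : c * c = 1 by rewrite /c; case: ifP; rewrite ?mulrNN mul1r.
have s2 p : rs p * rs p = 1 by exact: row_sign_sq.
case: eqP => [e|_].
  have e1 : a.1 = rev_ord a.2 by rewrite {1}e.
  have E'E : E' = E by rewrite /E' /twin -e.
  have tC : is_typeC t.
    move: ra; rewrite /is_root e1 label_rev_ord addNr ltxx andbF /=.
    by case/andP.
  rewrite scale0r addr0 dE E'E e1 row_sign_rev -/c -mulrA s2 mulr1 /c tC.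
  by rewrite scaleN1r.
have {}dE' : dagger E' = (rs a.1 * rs a.2) *: E.
  rewrite dE'; congr (_ *: _).
  transitivity (c * c * (rs a.1 * rs a.2)); first by ring.
  by rewrite cc mul1r.
case: eqP => [|nS]; first by rewrite scale1r.
have : rs a.1 * rs a.2 = 1 \/ rs a.1 * rs a.2 = -1.
  by rewrite /row_sign; do 2!case: ifP => _; rewrite ?mulrNN ?mul1r ?mulr1; auto.
case=> se; rewrite se in dE dE'; last first.
  by case: nS; rewrite daggerD dE dE' !scaleN1r opprD addrC.
by rewrite daggerD daggerZ dE dE' !scale1r !scaleN1r opprB addrC.
Qed.

Lemma root_E_in_ua (a : 'I_m * 'I_m) :
  is_root a -> blk a.2 < blk a.1 -> in_ua blk (root_E F a).
Proof.
move=> ra pa; split; last first.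
  by congr (_, _); [exact: root_mx_skew | apply/matrixP => i j];
    rewrite daggerE !mxE mulr0 oppr0.
split=> /= i j ij; rewrite !mxE //.
case: eqP => [ei|_] /=; first case: eqP => [ej|_] /=.
- by move: ij; rewrite ei ej leNgt pa.
- case: eqP => [ei'|_] /=; last by rewrite mulr0 addr0.
  case: eqP => [ej'|_] /=; last by rewrite mulr0 addr0.
  by move: ij; rewrite ei' ej' !blkN lerN2 leNgt pa.
case: eqP => [ei'|_] /=; last by rewrite mulr0 addr0.
case: eqP => [ej'|_] /=; last by rewrite mulr0 addr0.
by move: ij; rewrite ei' ej' !blkN lerN2 leNgt pa.
Qed.

Lemma root_F_in_ua (a : 'I_m * 'I_m) :
  is_root a -> blk a.1 < blk a.2 -> in_ua blk (root_F F a).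
Proof.
move=> ra pa; split; last first.
  by congr (_, _); [apply/matrixP => i j | exact: root_mx_skew];
    rewrite daggerE !mxE mulr0 oppr0.
split=> /= i j ij; rewrite !mxE //.
case: eqP => [ei|_] /=; first case: eqP => [ej|_] /=.
- by move: ij; rewrite ei ej leNgt pa.
- case: eqP => [ei'|_] /=; last by rewrite mulr0 addr0.
  case: eqP => [ej'|_] /=; last by rewrite mulr0 addr0.
  by move: ij; rewrite ei' ej' !blkN lerN2 leNgt pa.
case: eqP => [ei'|_] /=; last by rewrite mulr0 addr0.
case: eqP => [ej'|_] /=; last by rewrite mulr0 addr0.
by move: ij; rewrite ei' ej' !blkN lerN2 leNgt pa.
Qed.

End Checks.

(* Main.v *)
Require Import Defs.
From mathcomp Require Import all_boot all_order fingroup perm all_algebra.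
From mathcomp Require Import zify ring.

Set Implicit Arguments.
Unset Strict Implicit.
Unset Printing Implicit Defensive.

Import Order.TTheory GRing.Theory Num.Theory.
Import Defs.
Local Open Scope ring_scope.

(* The sum of the two components of an element of P (+) U_-^a is a full matrix,
   and the product becomes the matrix product in which the term p of entry
   (i, j) is kept only if the blocks of i, p, j follow each other within one
   turn of the cycle of blocks. Multiplying by the form matrix turns the action
   on u^a into this truncated congruence on matrices that are symmetric (type C)
   or alternating (types B, D).

   Existence: an entry of minimal cyclic weight can be used as a pivot, since
   truncation never prevents it from clearing its row and column; splitting off
   pivots leads to a monomial matrix. Torus elements normalize the entries to 1
   or delta, and two deltas in a block become two ones under a rotation with
   parameters x^2 + y^2 = 1/delta.

   Uniqueness: restriction to an arc of the cycle of blocks is multiplicative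
   into honest matrices, so the ranks of the arc restrictions are invariant; by
   induction on arcs they determine the number of rooks in every pair of blocks.
   On a symmetric arc the restriction is an honest congruence of symmetric
   forms, whose discriminant modulo squares gives the parity of the number of
   deltas on the arc. *)

(** The two summands of the algebra multiply by different rules, and one cyclic distance unifies
    them: along a path of blocks the distances add up to the distance of the ends plus a number of
    full periods 2l+1, and exactly the paths without a full period contribute to a product. The
    price is that truncation can swallow the very term that an elimination needs: a heavy pivot is
    useless against lighter entries. Type C is harder in both directions. A symmetric form has
    diagonal entries that obstruct an off-diagonal pivot, and labels survive in the normal form. A
    discriminant sees only a parity; condition (3) on basic pairs, at most one delta in each block,
    is what lets the parities on nested arcs recover the number of deltas block by block.
    Discriminants are compared only for two labellings of one rook placement, so the converse first
    carries D to D' by a Weyl element chosen without regard to labels. *)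

(* Distance from block x to block y read downwards and cyclically. The period is
   2l+1 even when the central block is empty: an empty block does no harm. *)
Definition cdist (l : nat) (x y : int) : int :=
  x - y + (if x < y then (2 * l + 1)%N%:Z else 0).

Ltac cdist_lia :=
  rewrite /cdist;
  repeat match goal with
  | |- context [if ?c then _ else _] => case: (boolP c) => ?
  end; try lia.

(** * The twisted matrix product *)

Section FullMatrix.
Variables (F : fieldType) (t : classical_type) (n l : nat).
Local Notation m := (msize t n).
Variable blk : 'I_m -> int.
Hypothesis blkN : forall i, blk (rev_ord i) = - blk i.
Hypothesis blk_le : forall i, `|blk i| <= l%:Z.
Local Notation K := ((2 * l + 1)%N%:Z).
Local Notation rs := (@row_sign F t n).
Implicit Types g h X Y : 'M[F]_m * 'M[F]_m.

Definition blk_dist i j := cdist l (blk i) (blk j).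
(* blk_wt i k is the distance attached to the entry of a bilinear form that
   comes from the matrix entry (i, -k). *)
Definition blk_wt i k := cdist l (blk i) (- blk k).
Definition fits (x : int) : F := (x < K)%R%:R.

Definition full X : 'M[F]_m := X.1 + X.2.

Lemma fullE X i j : in_alg blk X ->
  full X i j = if blk i < blk j then X.2 i j else X.1 i j.
Proof.
move=> [u lo]; rewrite mxE; case: ltP => ij; first by rewrite u ?add0r.
by rewrite lo ?addr0.
Qed.

Lemma full_inj X Y : in_alg blk X -> in_alg blk Y ->
  (forall i j, full X i j = full Y i j) -> X = Y.
Proof.
move=> aX aY e; have [uX lX] := aX; have [uY lY] := aY.
rewrite (surjective_pairing X) (surjective_pairing Y).
congr (_, _); apply/matrixP => i j; have := e i j; rewrite !fullE //;
  case: ltP => ij // _.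
- by rewrite uX ?uY.
- by rewrite lX ?lY.
Qed.

Lemma in_Ua_alg X : in_Ua blk X -> in_alg blk X.
Proof. by move=> [u lo]; split=> // i j ij; apply: u; apply: ltW. Qed.

(** Cases on the order of the three blocks. A term fails to fit exactly when both factors are
    strictly lower, where the algebra multiplies by zero, or when one factor is strictly lower and
    the entry is block upper, which the dual actions discard. *)
Lemma full_mul g h i j : in_alg blk g -> in_alg blk h ->
  full (alg_mul blk g h) i j =
  \sum_p fits (blk_dist i p + blk_dist p j) * full g i p * full h p j.
Proof.
move=> ag ah; rewrite (fullE _ _ (in_alg_mul ag ah)) /alg_mul /=.
have Ei := blk_le i; have Ej := blk_le j; have [gu gl] := ag; have [hu hl] := ah.
have s1 x : x < K -> fits x = 1 by move=> xK; rewrite /fits xK.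
have s0 x : K <= x -> fits x = 0 by move=> xK; rewrite /fits ltNge xK.
case: ltP => ij.
  rewrite /dual_actl /dual_actr !mxE ij -big_split /=.
  apply: eq_bigr => p _; rewrite !fullE // /blk_dist /cdist.
  have Ep := blk_le p; case: (ltP (blk i) (blk p)) => ip;
    case: (ltP (blk p) (blk j)) => pj.
  - by rewrite gu // hu // !(mul0r, mulr0) addr0 s0 ?mul0r //; lia.
  - by rewrite gu // mul0r add0r s1 ?mul1r //; lia.
  - by rewrite (gl i p) // mul0r addr0 s1 ?mul1r //; lia.
  - by have := lt_le_trans ij (le_trans pj ip); rewrite ltxx.
rewrite mxE; apply: eq_bigr => p _; rewrite !fullE // /blk_dist /cdist.
have Ep := blk_le p; case: (ltP (blk i) (blk p)) => ip;
  case: (ltP (blk p) (blk j)) => pj.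
- by have := lt_trans ip (lt_le_trans pj ij); rewrite ltxx.
- by rewrite gu // mul0r s0 ?mul0r //; lia.
- by rewrite hu // mulr0 s0 ?mul0r //; lia.
- by rewrite s1 ?mul1r //; lia.
Qed.

(** Merges nested truncations into one: a partial sum that exceeds the period keeps the total above
    it. Thus the two products in [Ga_act] need a single condition on the total distance. *)
Lemma short_mul a b c : 0 <= c -> (a + b < K -> a + b = c) ->
  forall e, 0 <= e -> fits (a + b) * fits (c + e) = fits (a + b + e).
Proof.
move=> c0 H e e0; rewrite /fits; case: ltP => [/H ->|ab]; first by rewrite mul1r.
by rewrite mul0r ltNge (le_trans ab) ?lerDl.
Qed.

Lemma dist_ge0 i j : 0 <= blk_dist i j.
Proof. by have := blk_le i; have := blk_le j; rewrite /blk_dist; cdist_lia. Qed.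

Lemma wt_ge0 i j : 0 <= blk_wt i j.
Proof. by have := blk_le i; have := blk_le j; rewrite /blk_wt; cdist_lia. Qed.

Lemma dist_add i p j : blk_dist i p + blk_dist p j < K -> blk_dist i p + blk_dist p j =
  blk_dist i j.
Proof.
by have := blk_le i; have := blk_le j; have := blk_le p; rewrite /blk_dist; cdist_lia.
Qed.

(* The row sign turns X into the matrix of a bilinear form, symmetric in type C
   and alternating in types B, D. *)
Definition toB X : 'M[F]_m := \matrix_(i, k) (rs k * full X i (rev_ord k)).

Lemma wtC i k : blk_wt i k = blk_wt k i.
Proof. by rewrite /blk_wt; cdist_lia. Qed.

Lemma dist_rev i k : blk_dist (rev_ord i) (rev_ord k) = blk_dist k i.
Proof. by rewrite /blk_dist !blkN; cdist_lia. Qed.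

Lemma dist_rev_r i k : blk_dist i (rev_ord k) = blk_wt i k.
Proof. by rewrite /blk_dist /blk_wt !blkN. Qed.

Lemma full_dagger g i j : full (alg_dagger g) i j =
  rs i * rs j * full g (rev_ord j) (rev_ord i).
Proof. by rewrite mxE !daggerE -mulrDr mxE. Qed.

Lemma toB_act g X i k : in_alg blk g -> in_alg blk X ->
  toB (Ga_act blk g X) i k =
  \sum_p \sum_q fits (blk_dist i p + blk_wt p q + blk_dist k q) *
     full g i p * full g k q * toB X p q.
Proof.
move=> ag aX; have agd := in_alg_dagger blkN ag; rewrite mxE.
rewrite /Ga_act full_mul //; last exact: in_alg_mul.
rewrite exchange_big /= (reindex_inj rev_ord_inj) /= mulr_sumr.
apply: eq_bigr => q _; rewrite full_mul // !mulr_sumr mulr_suml mulr_sumr.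
apply: eq_bigr => p _; rewrite full_dagger !rev_ordK [toB X _ _]mxE dist_rev -dist_rev_r.
rewrite -(@short_mul (blk_dist i p) (blk_dist p (rev_ord q)) (blk_dist i (rev_ord q))).
- rewrite !row_sign_rev; set c := if _ then _ else _.
  have cc : c * c = 1 by rewrite /c; case: ifP; rewrite ?mulrNN mul1r.
  have si : rs k * rs k = 1 by exact: row_sign_sq.
  set a := fits _; set b := fits _.
  transitivity (c * c * (rs k * rs k) * (a * b * full g i p * full g k q *
    (rs q * full X p (rev_ord q)))); first by ring.
  by rewrite cc si; ring.
- exact: dist_ge0.
- exact: dist_add.
- exact: dist_ge0.
Qed.

End FullMatrix.

(** * The group action as truncated congruence of bilinear forms *)

Section Orbits.
Variables (F : fieldType) (t : classical_type) (n l : nat).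
Local Notation m := (msize t n).
Variable blk : 'I_m -> int.
Hypothesis blkN : forall i, blk (rev_ord i) = - blk i.
Hypothesis blk_le : forall i, `|blk i| <= l%:Z.
Local Notation K := ((2 * l + 1)%N%:Z).
Local Notation rs := (@row_sign F t n).
Local Notation dist := (blk_dist l blk).
Local Notation wt := (blk_wt l blk).
Local Notation short := (fits F l).
Implicit Types g h X Y Z : 'M[F]_m * 'M[F]_m.

Lemma short1 x : x < K -> short x = 1.
Proof. by rewrite /fits => ->. Qed.

Lemma short0 x : K <= x -> short x = 0.
Proof. by rewrite /fits ltNge => ->. Qed.

(** Opposite to the symmetry of the form that defines G: skew elements for a symplectic form give
    symmetric matrices, those for an orthogonal form give alternating ones. *)
Definition form_sign : F := if is_typeC t then 1 else -1.

Lemma form_sign_sq : form_sign * form_sign = 1.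
Proof. by rewrite /form_sign; case: ifP; rewrite ?mulrNN mul1r. Qed.

Lemma row_sign_neq0 i : rs i != 0.
Proof. by apply/eqP => e; have := row_sign_sq F i; rewrite e mul0r => /eqP;
  rewrite eq_sym oner_eq0. Qed.

Lemma full_toB X i j : full X i j = rs (rev_ord j) * toB X i (rev_ord j).
Proof. by rewrite [toB _ _ _]mxE rev_ordK mulrA row_sign_sq mul1r. Qed.

Lemma wt_eq0 i k : (wt i k == 0) = (blk i == - blk k).
Proof.
have := blk_le i; have := blk_le k; rewrite /blk_wt => a b.
by apply/eqP/eqP; move: a b; cdist_lia.
Qed.

(** Weight zero marks the diagonal blocks, which [in_alg] admits and [in_ua] excludes; the symmetry
    of the form expresses the skewness under [dagger]. *)
Lemma in_uaP X : in_alg blk X ->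
  in_ua blk X <-> (forall i k, toB X k i = form_sign * toB X i k) /\
                  (forall i k, wt i k = 0 -> toB X i k = 0).
Proof.
move=> aX; have fsr i : rs (rev_ord i) = - form_sign * rs i.
  by rewrite row_sign_rev /form_sign; case: ifP; rewrite ?opprK.
split=> [[[u lo] sk]|[sy wz]].
  split=> i k.
    rewrite ![toB _ _ _]mxE.
    have := congr1 (fun Z => full Z k (rev_ord i)) sk.
    rewrite full_dagger rev_ordK => e.
    have -> : full X k (rev_ord i) = - full (- X) k (rev_ord i).
      by rewrite /full !mxE -opprD opprK.
    rewrite -e fsr; have si := row_sign_sq F i; have fs := form_sign_sq.
    transitivity (rs i * rs i * (form_sign * (rs k * full X i (rev_ord k)))); first by ring.
    by rewrite si mul1r.
  move=> /eqP; rewrite wt_eq0 => /eqP e; rewrite mxE (fullE _ _ aX) blkN e ltxx.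
  by rewrite u ?mulr0 // blkN e.
split; last first.
  apply: full_inj => //.
  - exact: in_alg_dagger.
  - by have [u lo] := aX; split=> i j ij; rewrite mxE ?u ?lo ?oppr0.
  move=> i j; have -> : full (- X) i j = - full X i j by rewrite /full !mxE -opprD.
  rewrite full_dagger !full_toB rev_ordK (sy i) fsr.
  have sj := row_sign_sq F i.
  transitivity (rs i * rs i * (form_sign * rs j * toB X i (rev_ord j))); first by ring.
  by rewrite sj; ring.
have [u lo] := aX; have z i j : blk i = blk j -> full X i j = 0.
  by move=> ij; rewrite full_toB wz ?mulr0 //; apply/eqP; rewrite wt_eq0 blkN opprK ij.
split=> // i j; rewrite le_eqVlt => /orP [/eqP ij|]; last exact: u.
by have := z _ _ ij; rewrite (fullE _ _ aX) ij ltxx.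
Qed.

Lemma wt_add i p q k : dist i p + wt p q + dist k q < K ->
  dist i p + wt p q + dist k q = wt i k.
Proof.
have := blk_le i; have := blk_le p; have := blk_le q; have := blk_le k.
by rewrite /blk_dist /blk_wt; cdist_lia.
Qed.

Lemma in_alg_act g X : in_alg blk g -> in_alg blk X -> in_alg blk (Ga_act blk g X).
Proof.
by move=> ag aX; apply: in_alg_mul; [exact: in_alg_mul | exact: in_alg_dagger].
Qed.

Lemma in_ua_act g X : in_alg blk g -> in_ua blk X -> in_ua blk (Ga_act blk g X).
Proof.
move=> ag uX; have aX : in_alg blk X by case: uX => /in_Ua_alg.
have [sy wz] := (in_uaP aX).1 uX; apply/in_uaP; first exact: in_alg_act.
split=> i k.
  rewrite !(toB_act blkN blk_le) // exchange_big mulr_sumr /=.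
  apply: eq_bigr => p _; rewrite mulr_sumr; apply: eq_bigr => q _.
  have -> : dist k q + wt q p + dist i p = dist i p + wt p q + dist k q.
    by rewrite (wtC l blk q p); ring.
  by rewrite (sy p q); ring.
move=> w0; rewrite (toB_act blkN blk_le) //.
apply: big1 => p _; apply: big1 => q _; rewrite /fits; case: ltP; last by rewrite !mul0r.
move=> /wt_add; rewrite w0 => e; rewrite wz ?mulr0 //.
have := dist_ge0 blk_le i p; have := dist_ge0 blk_le k q; have := wt_ge0 blk_le p q.
by move: e; set a := wt p q; set b := dist i p; set c := dist k q; lia.
Qed.

Lemma in_alg_one : in_alg blk (alg_one F t n).
Proof.
split=> i j ij; rewrite !mxE //; case: eqP => // e; by move: ij; rewrite e ltxx.
Qed.

Lemma alg_dagger_one : alg_dagger (alg_one F t n) = alg_one F t n.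
Proof.
rewrite /alg_dagger /=; congr (_, _); apply/matrixP => i j; rewrite daggerE !mxE ?mulr0 //.
rewrite (inj_eq rev_ord_inj) eq_sym; case: eqP => [->|_]; rewrite ?mulr0 //.
by rewrite mulr1 row_sign_sq.
Qed.

Lemma same_orbit_alg X Y : in_alg blk X -> same_Ga_orbit blk X Y -> in_alg blk Y.
Proof. by move=> aX [g [[ag _] ->]]; exact: in_alg_act. Qed.

Lemma same_orbit_ua X Y : in_ua blk X -> same_Ga_orbit blk X Y -> in_ua blk Y.
Proof. by move=> aX [g [[ag _] ->]]; exact: in_ua_act. Qed.

Lemma Ga_act_one X : in_alg blk X -> Ga_act blk (alg_one F t n) X = X.
Proof. by move=> aX; rewrite /Ga_act alg_dagger_one alg_mul1l // alg_mul1. Qed.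

Lemma Ga_act_mul g h X : in_alg blk g -> in_alg blk h -> in_alg blk X ->
  Ga_act blk g (Ga_act blk h X) = Ga_act blk (alg_mul blk g h) X.
Proof.
move=> ag ah aX; have agd := in_alg_dagger blkN ag; have ahd := in_alg_dagger blkN ah.
have agh := in_alg_mul ag ah; have ahX := in_alg_mul ah aX.
have aghX := in_alg_mul ag ahX.
rewrite /Ga_act alg_daggerM // (alg_mulA ag ahX ahd) -(alg_mulA aghX ahd agd).
by rewrite (alg_mulA ag ah aX).
Qed.

Lemma same_orbit_refl X : in_alg blk X -> same_Ga_orbit blk X X.
Proof.
move=> aX; exists (alg_one F t n); split; last by rewrite Ga_act_one.
split; first exact: in_alg_one.
by exists (alg_one F t n); split; rewrite ?alg_mul1 //; exact: in_alg_one.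
Qed.

Lemma in_Ga_mul g h : in_Ga blk g -> in_Ga blk h -> in_Ga blk (alg_mul blk g h).
Proof.
move=> [ag [g' [ag' gg' g'g]]] [ah [h' [ah' hh' h'h]]].
split; first exact: in_alg_mul.
have a1 := in_alg_mul ag ah; have a2 := in_alg_mul ah' ag'.
exists (alg_mul blk h' g'); split=> //.
- by rewrite -alg_mulA // (alg_mulA ah ah' ag') hh' alg_mul1l.
- by rewrite -alg_mulA // (alg_mulA ag' ag ah) g'g alg_mul1l.
Qed.

Lemma same_orbit_trans X Y Z : in_alg blk X ->
  same_Ga_orbit blk X Y -> same_Ga_orbit blk Y Z -> same_Ga_orbit blk X Z.
Proof.
move=> aX [g [Gg ->]] [h [Gh ->]]; exists (alg_mul blk h g).
split; first exact: in_Ga_mul.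
by case: Gg => ag _; case: Gh => ah _; rewrite Ga_act_mul.
Qed.

Lemma same_orbit_sym X Y : in_alg blk X ->
  same_Ga_orbit blk X Y -> same_Ga_orbit blk Y X.
Proof.
move=> aX [g [[ag [g' [ag' gg' g'g]]] ->]]; exists g'; split.
  by split=> //; exists g.
by rewrite Ga_act_mul // g'g Ga_act_one.
Qed.

(** A block diagonal factor only moves within a block, at distance zero, so truncation drops nothing
    and the congruence is an honest one. *)
Lemma levi_act (A A' : 'M[F]_m) X :
  (forall i j, blk i != blk j -> A i j = 0) ->
  (forall i j, blk i != blk j -> A' i j = 0) ->
  A *m A' = 1%:M -> in_alg blk X ->
  exists Y, same_Ga_orbit blk X Y /\ toB Y = A *m toB X *m A^T.
Proof.
move=> Ad A'd AA' aX.
have u (M : 'M[F]_m) : (forall i j, blk i != blk j -> M i j = 0) -> in_alg blk (M, 0 :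
  'M[F]_m).
  by move=> Md; split=> i j ij /=; rewrite ?mxE // Md // lt_eqF.
have aA := u _ Ad; have aA' := u _ A'd.
have mulE (M N : 'M[F]_m) : alg_mul blk (M, 0 : 'M[F]_m) (N, 0) = (M *m N, 0).
  rewrite /alg_mul /dual_actl /dual_actr /= mulmx0 mul0mx; congr (_, _).
  by apply/matrixP => i j; rewrite !mxE if_same addr0.
exists (Ga_act blk (A, 0) X); split.
  exists (A, 0); split=> //; split=> //; exists (A', 0); split=> //.
    by rewrite mulE AA'.
  by rewrite mulE (mulmx1C AA').
apply/matrixP => i k; rewrite (toB_act blkN blk_le) // exchange_big mxE.
apply: eq_bigr => q _; rewrite [X in _ = X * _]mxE [A^T _ _]mxE mulr_suml;
  apply: eq_bigr => p _.
have fE a b : full (A, 0) a b = A a b by rewrite /full /= addr0.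
rewrite !fE; have [ip|/Ad ->] := eqVneq (blk i) (blk p); last by rewrite !(mulr0, mul0r).
have [kq|/Ad ->] := eqVneq (blk k) (blk q); last by rewrite !(mulr0, mul0r).
rewrite short1; first by ring.
have := blk_le p; have := blk_le q; rewrite /blk_dist /blk_wt ip kq.
by move: (blk p) (blk q) => x y; cdist_lia.
Qed.

(* The group element is 1 plus the column p with entries c i, split between the
   two summands of the algebra. *)
Lemma column_act p (c : 'I_m -> F) X : c p = 0 -> in_alg blk X ->
  exists Y, same_Ga_orbit blk X Y /\ forall i k, toB Y i k =
    toB X i k + c i * short (dist i p + wt p k) * toB X p k
    + c k * short (dist k p + wt i p) * toB X i p
    + c i * c k * short (dist i p + wt p p + dist k p) * toB X p p.
Proof.
move=> cp aX.
(* The parameter [s] serves the inverse: since [c p = 0], the elements [g s] and [g (- s)] cancel.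
   The action uses [s = 1]. *)
pose g (s : F) : 'M[F]_m * 'M[F]_m :=
  (1%:M + \matrix_(i, j) (if (j == p) && (blk j <= blk i) then s * c i else 0),
   \matrix_(i, j) (if (j == p) && (blk i < blk j) then s * c i else 0)).
have ag s : in_alg blk (g s).
  split=> i j ij /=; rewrite !mxE.
    by rewrite [blk j <= _]leNgt ij andbF; case: eqP ij => [->|]; rewrite ?ltxx ?addr0.
  by rewrite ltNge ij andbF.
have fg s i j : full (g s) i j = (i == j)%:R + (if j == p then s * c i else 0).
  rewrite (fullE _ _ (ag s)) /= !mxE; case: ltP => ij; rewrite ?andbT //.
  by case: (eqVneq i j) ij => [->|]; rewrite ?ltxx ?add0r.
have K0 : 0 < K by lia.
have d0 i : dist i i = 0 by rewrite /blk_dist /cdist ltxx subrr addr0.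
have ginv s : alg_mul blk (g s) (g (- s)) = alg_one F t n.
  have am := in_alg_mul (ag s) (ag (- s)).
  apply: (full_inj am in_alg_one) => i j.
  rewrite (full_mul blk_le) // [full (alg_one _ _ _) _ _]mxE [X in _ + X]mxE addr0 mxE.
  have sh0 a b : short (dist a a + dist a b) = 1.
    have := blk_le a; have := blk_le b; rewrite d0 add0r => bb ba.
    by rewrite short1 //; move: ba bb; rewrite /blk_dist; cdist_lia.
  rewrite (bigD1 i) //= sh0 mul1r !fg eqxx.
  have [ip|ip] := eqVneq i p.
    rewrite ip cp !mulr0 addr0 mul1r if_same addr0 big1 ?addr0 // => q /negPf qi.
    by rewrite fg [p == q]eq_sym qi addr0 mulr0 mul0r.
  rewrite addr0 mul1r (bigD1 p) /=; last by rewrite eq_sym.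
  rewrite big1 ?addr0 => [|q /andP [qi qp]]; last first.
    by rewrite fg eq_sym (negPf qi) (negPf qp) addr0 mulr0 mul0r.
  rewrite !fg eqxx (negPf ip) add0r cp mulr0 if_same addr0 [p == j]eq_sym.
  case: (eqVneq j p) => [->|_]; last by rewrite mulr0 !addr0.
  rewrite d0 addr0 short1; first by rewrite mul1r mulr1 mulNr addrNK.
  have := blk_le i; have := blk_le p; rewrite /blk_dist; cdist_lia.
exists (Ga_act blk (g 1) X); split.
  exists (g 1); split=> //; split=> //; exists (g (- 1)); split=> //.
  by rewrite -{2}[1]opprK ginv.
move=> i k; rewrite (toB_act blkN blk_le) //.
have sum1 a (f : 'I_m -> F) : \sum_q full (g 1) a q * f q = f a + c a * f p.
  under eq_bigr => q _ do rewrite fg mul1r mulrDl.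
  rewrite big_split /= (bigD1 a) //= eqxx mul1r big1 ?addr0 => [|q /negPf qa]; last first.
    by rewrite eq_sym qa mul0r.
  rewrite (bigD1 p) //= eqxx big1 ?addr0 // => q /negPf qa.
  by rewrite qa mul0r.
transitivity (\sum_a full (g 1) i a * \sum_q full (g 1) k q *
  (short (dist i a + wt a q + dist k q) * toB X a q)).
  apply: eq_bigr => a _; rewrite mulr_sumr; apply: eq_bigr => q _.
  by move: (full (g 1)) => G; ring.
rewrite !sum1 !d0 !addr0 !add0r.
have -> : short (wt i k) = 1.
  have := blk_le i; have := blk_le k => bb ba.
  by rewrite short1 //; move: ba bb; rewrite /blk_wt; cdist_lia.
by rewrite [wt i p + _]addrC; ring.
Qed.

End Orbits.

(** * Reduction to monomial form *)

Section Reduction.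
Variables (F : fieldType) (t : classical_type) (n l : nat).
Local Notation m := (msize t n).
Variable blk : 'I_m -> int.
Hypothesis blkN : forall i, blk (rev_ord i) = - blk i.
Hypothesis blk_le : forall i, `|blk i| <= l%:Z.
Hypothesis char2 : (2%:R : F) != 0.
Local Notation K := ((2 * l + 1)%N%:Z).
Local Notation dist := (blk_dist l blk).
Local Notation wt := (blk_wt l blk).
Local Notation short := (fits F l).
Implicit Types (T : {set 'I_m}) (X Y : 'M[F]_m * 'M[F]_m).

(** The last clause prepares condition (3) on basic pairs: an entry (i, k) of the form is the matrix
    entry (i, -k), so the blocks with indices k and -k become diagonal blocks of the form. Rows of
    [T] may also be zero. *)
Definition split_off T (B : 'M[F]_m) := forall i k, i \in T -> B i k != 0 ->
  [/\ k \in T, forall k', B i k' != 0 -> k' = k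
    & is_typeC t -> blk i = blk k -> i = k].

Definition weight_ge T (w : int) (B : 'M[F]_m) :=
  forall i k, i \notin T -> k \notin T -> B i k != 0 -> w <= wt i k.

Definition reduced T w X := [/\ in_ua blk X, split_off T (toB X) & weight_ge T w (toB X)].

Lemma wt_addl i p k : dist i p + wt p k < K -> dist i p + wt p k = wt i k.
Proof.
have := blk_le i; have := blk_le p; have := blk_le k.
by rewrite /blk_dist /blk_wt; cdist_lia.
Qed.

(** The sum agrees with [wt i k] modulo the period; if it wrapped around, [dist i p] being below the
    period would make [wt i k] smaller than [wt p k]. For a pivot of minimal weight the hypothesis
    holds at every entry to be cleared. *)
Lemma short_wt_le i p k : wt p k <= wt i k -> short (dist i p + wt p k) = 1.
Proof.
move=> h; apply: short1; move: h.
have := blk_le i; have := blk_le p; have := blk_le k.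
by rewrite /blk_dist /blk_wt; cdist_lia.
Qed.

Lemma toB_sym X i k : in_ua blk X -> toB X k i = form_sign F t * toB X i k.
Proof.
move=> uX; have aX : in_alg blk X by case: uX => /in_Ua_alg.
by have [-> _] := (in_uaP blkN blk_le aX).1 uX.
Qed.

Lemma toB_sym0 X i k : in_ua blk X -> toB X i k = 0 -> toB X k i = 0.
Proof. by move=> uX e; rewrite (toB_sym i k) // e mulr0. Qed.

Lemma form_sign_neq0 : form_sign F t != 0.
Proof. by rewrite /form_sign; case: ifP; rewrite ?oppr_eq0 oner_eq0. Qed.

Lemma split_off_col T X i p : split_off T (toB X) ->
  i \in T -> p \notin T -> toB X i p = 0.
Proof. by move=> sX iT pT; apply/eqP; apply: contraNT pT => /(sX _ _ iT) []. Qed.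

(** A term that survives truncation comes from an entry no heavier than its target, so nothing below
    weight [w] can appear. Rows in [T] do not change, because [c] and column [p] both vanish
    there. *)
Lemma column_step T w p (c : 'I_m -> F) X :
  reduced T w X -> p \notin T -> c p = 0 -> {in T, forall i, c i = 0} ->
  exists Y, [/\ same_Ga_orbit blk X Y, reduced T w Y & forall i k, toB Y i k =
    toB X i k + c i * short (dist i p + wt p k) * toB X p k
    + c k * short (dist k p + wt i p) * toB X i p
    + c i * c k * short (dist i p + wt p p + dist k p) * toB X p p].
Proof.
move=> [uX sX wX] pT cp cT; have aX : in_alg blk X by case: uX => /in_Ua_alg.
have [Y [oY YE]] := column_act blkN blk_le cp aX.
exists Y; split=> //; have uY := same_orbit_ua blkN blk_le uX oY.
split=> //.
  have row i k : i \in T -> toB Y i k = toB X i k.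
    by move=> iT; rewrite YE cT // (split_off_col sX iT pT) !(mulr0, mul0r) !addr0.
  move=> i k iT; rewrite row // => /(sX _ _ iT) [kT u b].
  by split=> // k'; rewrite row //; apply: u.
move=> i k iT kT; rewrite leNgt; apply: contraNN => ik.
have low p' k' : p' \notin T -> k' \notin T -> wt p' k' < w -> toB X p' k' = 0.
  move=> p'T k'T lt; apply/eqP; apply: contraTT lt => /(wX _ _ p'T k'T).
  by rewrite -leNgt.
have t1 x y : y \notin T -> wt x y < w -> short (dist x p + wt p y) * toB X p y = 0.
  move=> yT xy; have [lt|/short0 ->] := ltP (dist x p + wt p y) K; last by rewrite mul0r.
  rewrite low ?mulr0 //; apply: le_lt_trans xy.
  by rewrite -(wt_addl lt) lerDr; exact: dist_ge0.
have t3 : short (dist i p + wt p p + dist k p) * toB X p p = 0.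
  have [lt|/short0 ->] := ltP (dist i p + wt p p + dist k p) K; last by rewrite mul0r.
  rewrite low ?mulr0 //; apply: le_lt_trans ik; rewrite -(wt_add blk_le lt).
  by rewrite addrAC lerDr addr_ge0 //; exact: dist_ge0.
rewrite YE (low i k) // -!mulrA t1 // t3 (wtC l blk i p) (toB_sym p i) //.
by rewrite [_ * (form_sign _ _ * _)]mulrCA t1 ?(wtC l blk k) // !mulr0 !addr0.
Qed.

Lemma split_off_setU1 T p X : in_ua blk X -> split_off T (toB X) ->
  (forall k, toB X p k != 0 -> k = p) -> split_off (p |: T) (toB X).
Proof.
move=> uX sX pp i k /setU1P [-> nz|iT /(sX _ _ iT) [kT u b]].
  by rewrite (pp _ nz) setU11.
by rewrite setU1r.
Qed.

Lemma diagonal_pivot T p X : reduced T (wt p p) X -> p \notin T ->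
  toB X p p != 0 ->
  exists Y, [/\ same_Ga_orbit blk X Y, in_ua blk Y & split_off (p |: T) (toB Y)].
Proof.
move=> rX pT pp; have [uX sX wX] := rX.
pose c i := if i == p then 0 else - toB X i p / toB X p p.
have cp : c p = 0 by rewrite /c eqxx.
have cT : {in T, forall i, c i = 0}.
  by move=> i iT; rewrite /c (split_off_col sX) // oppr0 mul0r if_same.
have [Y [oY [uY sY wY] YE]] := column_step rX pT cp cT.
exists Y; split=> //; apply: split_off_setU1 => // k; apply: contraNeq => kp.
rewrite (toB_sym k p) // mulf_eq0; apply/orP; right; rewrite YE cp.
rewrite !(mul0r, mulr0) !addr0.
have ck : c k = - toB X k p / toB X p p by rewrite /c (negPf kp).
have [kp0|kpnz] := eqVneq (toB X k p) 0.
  by rewrite ck kp0 oppr0 !mul0r addr0.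
have kT : k \notin T by apply: contraNN pT => /sX /(_ kpnz) [].
rewrite short_wt_le ?mulr1; last exact: wX.
by rewrite ck divfK // subrr.
Qed.

(** Half of the elimination with a hyperbolic pivot: multiples of row [p] clear column [q]. The zero
    at (q, q) gives [c q = 0], and the zero at (p, p) leaves row [p] unchanged, so that the other
    half is this lemma with [p] and [q] exchanged. *)
Lemma off_diagonal_clear T p q X : reduced T (wt p q) X ->
  p \notin T -> q \notin T -> p != q -> toB X p q != 0 ->
  toB X p p = 0 -> toB X q q = 0 ->
  exists Y, [/\ same_Ga_orbit blk X Y, reduced T (wt p q) Y,
    forall i, i != p -> toB Y i q = 0, forall k, toB Y p k = toB X p k
    & toB Y q q = 0].
Proof.
move=> rX pT qT pq pqnz pp qq; have [uX sX wX] := rX.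
pose c i := if i == p then 0 else - toB X i q / toB X p q.
have cp : c p = 0 by rewrite /c eqxx.
have cq : c q = 0 by rewrite /c eq_sym (negPf pq) qq oppr0 mul0r.
have cT : {in T, forall i, c i = 0}.
  by move=> i iT; rewrite /c (split_off_col sX iT qT) oppr0 mul0r if_same.
have [Y [oY rY YE]] := column_step rX pT cp cT.
have iq i : i != p -> toB Y i q = 0.
  move=> ip; rewrite YE cq pp !(mul0r, mulr0) !addr0.
  have ci : c i = - toB X i q / toB X p q by rewrite /c (negPf ip).
  have [iq0|iqnz] := eqVneq (toB X i q) 0.
    by rewrite ci iq0 oppr0 !mul0r addr0.
  have iT : i \notin T by apply: contraNN qT => /sX /(_ iqnz) [].
  rewrite short_wt_le ?mulr1; last exact: wX.
  by rewrite ci divfK // subrr.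
exists Y; split=> // [k|]; last by rewrite iq // eq_sym.
by rewrite YE cp pp !(mul0r, mulr0) !addr0.
Qed.

Lemma off_diagonal_pivot T p q X : reduced T (wt p q) X ->
  p \notin T -> q \notin T -> p != q -> toB X p q != 0 ->
  (is_typeC t -> blk p != blk q) ->
  toB X p p = 0 -> toB X q q = 0 ->
  exists Y, [/\ same_Ga_orbit blk X Y, in_ua blk Y & split_off ([set p; q] :|: T) (toB Y)].
Proof.
move=> rX pT qT pq pqnz bpq pp qq; have [uX _ _] := rX.
have [Y [oY rY iq pk qq']] := off_diagonal_clear rX pT qT pq pqnz pp qq.
have [uY _ _] := rY; have pp' : toB Y p p = 0 by rewrite pk.
rewrite (wtC l blk p q) in rY.
have qpnz : toB Y q p != 0.
  by rewrite (toB_sym p q) // pk mulf_neq0 // form_sign_neq0.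
have qp : q != p by rewrite eq_sym.
have [Z [oZ rZ ip qk ppZ]] := off_diagonal_clear rY qT pT qp qpnz qq' pp'.
have [uZ sZ _] := rZ.
exists Z; split=> //; first by apply: (same_orbit_trans blkN) oY oZ; case: uX => /in_Ua_alg.
have rp k : toB Z p k != 0 -> k = q.
  by apply: contraNeq => kq; rewrite (toB_sym0 (i := k)) // ip.
have rq k : toB Z q k != 0 -> k = p.
  by apply: contraNeq => kp; rewrite qk (toB_sym0 (i := k)) // iq.
move=> i k; rewrite -setUA => /setU1P [->|/setU1P [->|iT /(sZ _ _ iT) [kT u b]]].
- move=> nz; rewrite (rp _ nz); split; first by rewrite !inE eqxx orbT.
    by move=> k'; exact: rp.
  by move=> /bpq /eqP.
- move=> nz; rewrite (rq _ nz); split; first by rewrite !inE eqxx.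
    by move=> k'; exact: rq.
  by move=> /bpq /eqP bb /esym.
by split=> //; rewrite !inE kT !orbT.
Qed.

(** Adding [c] times row [p] to row [q] changes the entry at (q, q) by twice [c] times the pivot.
    The quadratic term, and the change of the pivot itself, both involve the entry at (p, p) and are
    truncated away because the blocks differ. *)
Lemma clear_diagonal T p q X : reduced T (wt p q) X ->
  p \notin T -> q \notin T -> blk p != blk q -> toB X p q != 0 ->
  is_typeC t ->
  exists Y, [/\ same_Ga_orbit blk X Y, reduced T (wt p q) Y, toB Y q q = 0,
    toB Y p q = toB X p q & toB Y p p = toB X p p].
Proof.
move=> rX pT qT pq pqnz tC; have [uX sX wX] := rX.
pose c i := if i == q then - toB X q q / (2%:R * toB X p q) else 0.
have npq : p != q by apply: contraNneq pq => ->.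
have cp : c p = 0 by rewrite /c (negPf npq).
have cT : {in T, forall i, c i = 0}.
  by move=> i iT; rewrite /c; case: eqP iT qT => // -> ->.
have [Y [oY rY YE]] := column_step rX pT cp cT.
have cq : c q = - toB X q q / (2%:R * toB X p q) by rewrite /c eqxx.
(* Otherwise the sum would equal [wt q p], which by minimality is at most [wt p p]; this forces
   [dist q p = 0], against the blocks being different. *)
have far : toB X p p != 0 -> K <= dist q p + wt p p.
  move=> /(wX _ _ pT pT); move: pq; have := blk_le p; have := blk_le q.
  by rewrite /blk_dist /blk_wt => ? ? /eqP ?; cdist_lia.
exists Y; split=> //.
- rewrite YE (wtC l blk q p) -!mulrA.
  have -> : toB X q p = toB X p q by rewrite (toB_sym p q) // /form_sign tC mul1r.
  have -> : short (dist q p + wt p p + dist q p) * toB X p p = 0 :> F.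
    have [->|/far h] := eqVneq (toB X p p) 0; first by rewrite mulr0.
    by rewrite short0 ?mul0r // (le_trans h) // lerDl; exact: dist_ge0.
  have [qq0|qqnz] := eqVneq (toB X q q) 0.
    by rewrite cq qq0 oppr0 !mul0r !addr0.
  rewrite !mulr0 addr0 short_wt_le; last by rewrite wX.
  by rewrite cq; field; rewrite pqnz.
- rewrite YE cp !(mul0r, mulr0) !addr0.
  have [->|/far h] := eqVneq (toB X p p) 0; first by rewrite mulr0 addr0.
  by rewrite short0 // !(mul0r, mulr0) addr0.
- by rewrite YE cp !(mul0r, mulr0) !addr0.
Qed.

Lemma pivot_step T X : in_ua blk X -> split_off T (toB X) -> T != setT ->
  exists Y T', [/\ same_Ga_orbit blk X Y, in_ua blk Y, split_off T' (toB Y)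
    & T \proper T'].
Proof.
move=> uX sX TnT; have aX : in_alg blk X by case: uX => /in_Ua_alg.
pose P (a : 'I_m * 'I_m) := [&& a.1 \notin T, a.2 \notin T & toB X a.1 a.2 != 0].
(* With no entry left outside [T], the remaining rows vanish by symmetry and all indices can join
   [T] at once. *)
have [a0 Pa0|noP] := pickP P; last first.
  exists X, setT; split=> //; first exact: same_orbit_refl.
    move=> i k _ nz; case: (boolP (i \in T)) => iT.
      by have [_ u b] := sX _ _ iT nz; rewrite inE.
    case: (boolP (k \in T)) => kT; last by have := noP (i, k); rewrite /P /= iT kT nz.
    have /(sX _ _ kT) [] : toB X k i != 0.
      by apply: contraNneq nz => e; rewrite (toB_sym0 (i := k)).
    by rewrite (negPf iT).
  by rewrite properEneq TnT subsetT.
have [[p q] /and3P [/= pT qT pqnz] mn] := @arg_minnP _ a0 P (fun a => `|wt a.1 a.2|%N) Pa0.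
have rX : reduced T (wt p q) X.
  split=> // i k iT kT nz; have /(_ _) := mn (i, k); rewrite /P /= iT kT nz => /(_ isT).
  by have := wt_ge0 blk_le p q; have := wt_ge0 blk_le i k; lia.
have proper1 i S : i \notin T -> T \proper i |: (S :|: T).
  move=> iT; rewrite properE setUA subsetUr; apply: contraNN iT => /subsetP; apply.
  by rewrite !inE eqxx.
have one r Y : r \notin T -> toB Y r r != 0 -> same_Ga_orbit blk X Y ->
    reduced T (wt r r) Y -> exists Y T', [/\ same_Ga_orbit blk X Y, in_ua blk Y,
      split_off T' (toB Y) & T \proper T'].
  move=> rT rr oY rY; have [Z [oZ uZ sZ]] := diagonal_pivot rY rT rr.
  exists Z, (r |: T); split=> //; first exact: (same_orbit_trans blkN) oY oZ.
  by rewrite -[T in _ |: T]set0U proper1.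
have [pq|pq] := eqVneq p q.
  by apply: (one p X) => //; [rewrite {2}pq | exact: same_orbit_refl | rewrite {2}pq].
have two Y : same_Ga_orbit blk X Y -> reduced T (wt p q) Y -> toB Y p q != 0 ->
    (is_typeC t -> blk p != blk q) -> toB Y p p = 0 -> toB Y q q = 0 ->
    exists Y T', [/\ same_Ga_orbit blk X Y, in_ua blk Y,
      split_off T' (toB Y) & T \proper T'].
  move=> oY rY nz b pp qq.
  have [Z [oZ uZ sZ]] := off_diagonal_pivot rY pT qT pq nz b pp qq.
  exists Z, ([set p; q] :|: T); split=> //; first exact: (same_orbit_trans blkN) oY oZ.
  by rewrite -setUA proper1.
case tC: (is_typeC t); last first.
  have diag0 i : toB X i i = 0.
    have := toB_sym i i uX; rewrite /form_sign tC mulN1r => /eqP.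
    rewrite -addr_eq0 -mulr2n -[toB X i i]mulr1 -mulrnAr mulf_eq0 (negPf char2) orbF.
    by rewrite mulr1 => /eqP.
  by apply: (two X) => //; [exact: same_orbit_refl | rewrite tC].
have [bpq|bpq] := eqVneq (blk p) (blk q); last first.
  (* Each clearing keeps the other diagonal entry and the pivot, so two of them with exchanged roles
     leave a hyperbolic pair. *)
  have [Y [oY rY qq pqE ppE]] := clear_diagonal rX pT qT bpq pqnz tC.
  have [uY _ _] := rY; rewrite (wtC l blk p q) in rY.
  have qpY : toB Y q p != 0.
    by rewrite (toB_sym p q) // pqE mulf_neq0 // form_sign_neq0.
  have bqp : blk q != blk p by rewrite eq_sym.
  have [Z [oZ rZ pp qpE qqE]] := clear_diagonal rY qT pT bqp qpY tC.
  have [uZ _ _] := rZ; apply: (two Z) => //.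
  - exact: (same_orbit_trans blkN) oY oZ.
  - by rewrite (wtC l blk p q).
  - by rewrite (toB_sym q p) // qpE mulf_neq0 // form_sign_neq0.
  - by rewrite qqE.
(* Within one block [split_off] accepts only diagonal pivots. The entries at (p, p) and (q, q) have
   the same minimal weight here, so a nonzero one can serve directly. *)
have wE : wt p p = wt p q by rewrite /blk_wt bpq.
have wE' : wt q q = wt p q by rewrite /blk_wt bpq.
have [pp|ppnz] := eqVneq (toB X p p) 0; last first.
  by apply: (one p X) => //; [exact: same_orbit_refl | rewrite wE].
have [qq|qqnz] := eqVneq (toB X q q) 0; last first.
  by apply: (one q X) => //; [exact: same_orbit_refl | rewrite wE'].
(* Both diagonal entries vanish and lie in the same block as B_pq: replacing
   row p by p + q makes the first of them 2 B_pq. *)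
pose c i := (i == p)%:R : F.
have cq : c q = 0 by rewrite /c eq_sym (negPf pq).
have cp : c p = 1 by rewrite /c eqxx.
have cT : {in T, forall i, c i = 0}.
  by move=> i iT; rewrite /c; case: eqP iT pT => // -> ->.
have [Y [oY rY YE]] := column_step rX qT cq cT.
apply: (one p Y) => //; last by rewrite wE.
rewrite YE pp qq cp mulr0 add0r addr0 mul1r (wtC l blk p q).
rewrite (_ : toB X q p = toB X p q); last by rewrite (toB_sym p q) // /form_sign tC mul1r.
rewrite short_wt_le ?mul1r; last by rewrite (wtC l blk q p) wE.
by rewrite -mulr2n -mulr_natr mulf_neq0.
Qed.

Lemma reduction X : in_ua blk X -> exists Y,
  [/\ same_Ga_orbit blk X Y, in_ua blk Y & split_off setT (toB Y)].
Proof.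
move=> uX; have aX : in_alg blk X by case: uX => /in_Ua_alg.
suff H N T Y : (#|~: T| <= N)%N -> same_Ga_orbit blk X Y -> in_ua blk Y ->
    split_off T (toB Y) -> exists Y,
  [/\ same_Ga_orbit blk X Y, in_ua blk Y & split_off setT (toB Y)].
  apply: (H _ set0 X (leqnn _)) => //; first exact: same_orbit_refl.
  by move=> i k; rewrite inE.
elim: N T Y => [|N IH] T Y cT oY uY sY.
  exists Y; split=> //; suff <- : T = setT by [].
  by apply/setP => i; move: cT; rewrite leqn0 cards_eq0 => /eqP /setP /(_ i);
    rewrite !inE => /negPn.
have [TT|TnT] := eqVneq T setT; first by exists Y; split=> //; rewrite -TT.
have [Z [T' [oZ uZ sZ TT']]] := pivot_step uY sY TnT.
apply: (IH T' Z) => //; last exact: (same_orbit_trans blkN) oY oZ.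
have := proper_card TT'; have := cardsC T; have := cardsC T'.
by move: cT; set x := #|~: T|; set y := #|~: T'|; lia.
Qed.
End Reduction.

(** * Roots, supports and monomial elements *)

Section Support.
Variables (F : fieldType) (t : classical_type) (n l : nat).
Local Notation m := (msize t n).
Variable blk : 'I_m -> int.
Hypothesis blkN : forall i, blk (rev_ord i) = - blk i.
Hypothesis blk_le : forall i, `|blk i| <= l%:Z.
Local Notation rs := (@row_sign F t n).
Implicit Types (X Y : 'M[F]_m * 'M[F]_m) (D : {set 'I_m * 'I_m}) (a b : 'I_m * 'I_m).
Implicit Types phi psi : 'I_m * 'I_m -> F.

Lemma twinK : involutive (@twin t n).
Proof. by case=> i j; rewrite /twin /= !rev_ordK. Qed.

Lemma antidiag_twin a : antidiag a = (twin a == a).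
Proof.
case: a => i j; rewrite /antidiag /twin /= xpair_eqE.
by apply/eqP/andP => [->|[_ /eqP]] //; rewrite rev_ordK !eqxx.
Qed.

(** [twin] negates the sum of the two labels, which is positive at every root off the
    antidiagonal. *)
Lemma root_twin a : is_root a -> is_root (twin a) -> antidiag a.
Proof.
case/orP => [/andP [_ p1]|/andP [] //].
case/orP => [/andP [_ p2]|/andP [_]].
  by move: p1 p2; rewrite /twin /= !label_rev_ord; lia.
by rewrite antidiag_twin twinK eq_sym -antidiag_twin.
Qed.

Lemma antidiag_root a : antidiag a -> is_root a = is_typeC t.
Proof. by move=> aa; rewrite /is_root aa andbT (eqP aa) label_rev_ord subrr ltxx andbF. Qed.

Variant root_spec a : Prop :=
  | RootSelf of is_root a
  | RootTwin of is_root (twin a)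
  | RootNone of antidiag a & is_typeC t = false.

Lemma rootP a : a.1 != a.2 -> root_spec a.
Proof.
case: a => i j /= ij; have [lt|gt|eq] := ltgtP 0 (label i + label j).
- by apply: RootSelf; rewrite /is_root /= ij lt.
- apply: RootTwin; rewrite /is_root /twin /= !label_rev_ord.
  by rewrite (inj_eq rev_ord_inj) eq_sym ij; apply/orP; left; lia.
have aij : antidiag (i, j).
  by apply/eqP; apply: (@label_inj t n); rewrite label_rev_ord /=; lia.
case tC: (is_typeC t); last exact: RootNone.
by apply: RootSelf; rewrite antidiag_root.
Qed.

Lemma ua_alg X : in_ua blk X -> in_alg blk X.
Proof. by case=> /in_Ua_alg. Qed.

Lemma full_skew X i j : in_ua blk X ->
  full X (rev_ord j) (rev_ord i) = - (rs i * rs j) * full X i j.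
Proof.
move=> [_ sk]; have := congr1 (fun Z => full Z i j) sk; rewrite full_dagger.
have -> : full (- X) i j = - full X i j by rewrite /full !mxE -opprD.
have si := row_sign_sq F i; have sj := row_sign_sq F j => e.
rewrite mulNr -mulrN -e;
  transitivity (rs i * rs i * (rs j * rs j) * full X (rev_ord j) (rev_ord i)); last by ring.
by rewrite si sj !mul1r.
Qed.

Lemma full_twin_neq0 X a : in_ua blk X ->
  (full X (twin a).1 (twin a).2 != 0) = (full X a.1 a.2 != 0).
Proof.
by move=> uX; rewrite /twin /= full_skew // mulf_eq0 oppr_eq0 mulf_eq0 !(negPf
  (row_sign_neq0 F _)).
Qed.

Lemma full_block0 X i j : in_ua blk X -> blk i = blk j -> full X i j = 0.
Proof.
by move=> uX e; have aX := ua_alg uX; case: uX => [[u _] _];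
  rewrite (fullE _ _ aX) e ltxx u ?e.
Qed.

Lemma full_blk_neq X i j : in_ua blk X -> full X i j != 0 -> blk i != blk j.
Proof. by move=> uX; apply: contraNneq => e; rewrite full_block0. Qed.

Hypothesis char2 : (2%:R : F) != 0.

Lemma full_antidiag0 X a : in_ua blk X -> is_typeC t = false -> antidiag a ->
  full X a.1 a.2 = 0.
Proof.
move=> uX tC /eqP ->; have := full_skew a.1 (rev_ord a.1) uX.
rewrite rev_ordK row_sign_rev tC mul1r row_sign_sq mulN1r => /eqP.
by rewrite -addr_eq0 -mulr2n -mulr_natr mulf_eq0 (negPf char2) orbF => /eqP.
Qed.

Lemma ua_ext X Y : in_ua blk X -> in_ua blk Y ->
  (forall a, root_ua blk a -> full X a.1 a.2 = full Y a.1 a.2) -> X = Y.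
Proof.
move=> uX uY e; apply: (full_inj (ua_alg uX) (ua_alg uY)) => i j.
have [bij|bij] := eqVneq (blk i) (blk j); first by rewrite !full_block0.
have ij : i != j by apply: contraNneq bij => ->.
case: (@rootP (i, j) ij) => [r|r|ad tC].
- by apply: (e (i, j)); rewrite /root_ua r.
- rewrite -[i]rev_ordK -[j]rev_ordK !(full_skew (rev_ord j)) //.
  have := e (twin (i, j)); rewrite /root_ua r /twin /= !blkN eqr_opp eq_sym bij.
  by move=> ->.
- by rewrite (full_antidiag0 uX tC ad) (full_antidiag0 uY tC ad).
Qed.

Lemma in_ua_lin (c : F) X Y : in_ua blk X -> in_ua blk Y -> in_ua blk (c *: X + Y).
Proof.
move=> [[uX lX] sX] [[uY lY] sY]; split.
  by split=> i j ij; rewrite !mxE ?uX ?uY ?lX ?lY // mulr0 addr0.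
have [sX1 sX2] : dagger X.1 = - X.1 /\ dagger X.2 = - X.2 by case: sX.
have [sY1 sY2] : dagger Y.1 = - Y.1 /\ dagger Y.2 = - Y.2 by case: sY.
by rewrite /alg_dagger /= !daggerD !daggerZ sX1 sX2 sY1 sY2; congr (_, _);
  rewrite opprD scalerN.
Qed.

Lemma in_ua0 : in_ua blk (0 : 'M[F]_m * 'M[F]_m).
Proof.
split; first by split=> i j _; rewrite mxE.
rewrite oppr0; congr (_, _); apply/matrixP => i j; rewrite daggerE !mxE mulr0 //.
Qed.

Lemma in_ua_sum (I : finType) (P : pred I) (c : I -> F) (f : I -> 'M[F]_m * 'M[F]_m) :
  (forall x, P x -> in_ua blk (f x)) -> in_ua blk (\sum_(x | P x) c x *: f x).
Proof.
move=> H; elim/big_rec: _ => [|x Y Px uY]; first exact: in_ua0.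
by apply: in_ua_lin => //; apply: H.
Qed.

Lemma calX_ua D phi : {in D, forall a, root_ua blk a} -> in_ua blk (calX blk D phi).
Proof.
move=> rD; rewrite /calX -[X in X + _]scale1r; apply: in_ua_lin; apply: in_ua_sum => a.
  by rewrite inE => /andP [/rD /andP [ra _] p]; exact: root_E_in_ua.
by rewrite inE => /andP [/rD /andP [ra _] p]; exact: root_F_in_ua.
Qed.

(** The second summand of [root_mx] sits at [twin a], which is a root only on the antidiagonal, and
    there [eta] vanishes. *)
Lemma root_mx_root a b : is_root a -> is_root b -> root_mx F a b.1 b.2 = (a == b)%:R.
Proof.
case: a b => [i j] [i' j'] ra rb; rewrite /root_mx /elem_mx /twin !mxE /=.
rewrite [_ == (i', j')]eq_sym !xpair_eqE;
  case: (boolP ((i' == rev_ord j) && _)) => [/andP [/eqP e1 /eqP e2]|_].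
  have tw : (i', j') = twin (i, j) by rewrite /twin e1 e2.
  have aa : antidiag (i, j) by apply: root_twin => //; rewrite -tw.
  by rewrite /eta [X in if X then _ else _]eq_sym -antidiag_twin aa mul0r addr0.
by rewrite mulr0 addr0.
Qed.

Lemma full_calX D phi a : {in D, forall a, root_ua blk a} -> root_ua blk a ->
  full (calX blk D phi) a.1 a.2 = if a \in D then phi a else 0.
Proof.
move=> rD /andP [ra _]; rewrite /full /calX /=.
have sumE (P : {set 'I_m * 'I_m}) (f : 'I_m * 'I_m -> 'M[F]_m * 'M[F]_m) :
    full (\sum_(x in P) phi x *: f x) a.1 a.2 = \sum_(x in P) phi x * full (f x) a.1 a.2.
  elim/big_rec2: _ => [|x y Z _ <-]; first by rewrite /full !mxE addr0.
  by rewrite /full !mxE mulrDr; ring.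
have -> : forall A B : 'M[F]_m * 'M[F]_m, (A + B).1 + (A + B).2 = full A + full B.
  by move=> A B; rewrite /full /= addrACA.
rewrite mxE !sumE.
transitivity (\sum_(x in D) phi x * root_mx F x a.1 a.2).
  rewrite [RHS](bigID (fun x => blk x.2 < blk x.1)) /=; congr (_ + _).
    apply: eq_big => [x|x _]; first by rewrite inE.
    by rewrite /full /root_E /= addr0.
  apply: eq_big => [x|x _]; last by rewrite /full /root_F /= add0r.
  rewrite inE; case xD: (x \in D) => //=; have /andP [_ bx] := rD _ xD.
  by rewrite -leNgt le_eqVlt (negPf bx).
rewrite (eq_bigr (fun x => phi x * (x == a)%:R)) => [|x xD]; last first.
  by rewrite root_mx_root //; case/andP: (rD _ xD).
case: ifP => aD.
  rewrite (bigD1 a) //= eqxx mulr1 big1 ?addr0 // => x /andP [_ /negPf ->].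
  by rewrite mulr0.
apply: big1 => x xD; case: eqP => [xa|]; last by rewrite mulr0.
by rewrite xa aD in xD.
Qed.

Definition root_support X : {set 'I_m * 'I_m} :=
  [set a | is_root a && (full X a.1 a.2 != 0)].

(** A condition on rows is enough: on skew elements [twin] turns rows into columns, see
    [monomial_col]. *)
Definition monomial X :=
  forall i j j', full X i j != 0 -> full X i j' != 0 -> j = j'.

Lemma root_support_ua X : in_ua blk X -> {in root_support X, forall a, root_ua blk a}.
Proof.
by move=> uX a; rewrite inE /root_ua => /andP [-> /(full_blk_neq uX) ->].
Qed.

Lemma support_twins X a : in_ua blk X ->
  (a \in root_support X :|: twins (root_support X)) = (full X a.1 a.2 != 0).
Proof.
move=> uX; have tw : (a \in twins (root_support X)) = (twin a \in root_support X).
  by rewrite -{1}[a]twinK mem_imset //; exact: (can_inj twinK).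
rewrite in_setU tw !inE full_twin_neq0 // -andb_orl andbC.
have [//|nz] := eqVneq (full X a.1 a.2) 0; have bij := full_blk_neq uX nz.
have ij : a.1 != a.2 by apply: contraNneq bij => ->.
case: (rootP ij) => [->|->|ad tC] //; first by rewrite orbT.
by rewrite (full_antidiag0 uX tC ad) eqxx in nz.
Qed.

Lemma monomial_col X i i' j : in_ua blk X -> monomial X ->
  full X i j != 0 -> full X i' j != 0 -> i = i'.
Proof.
move=> uX mX; rewrite -(full_twin_neq0 (i, j)) // -(full_twin_neq0 (i', j)) //.
by move=> n1 n2; apply: rev_ord_inj; exact: (mX _ _ _ n1 n2).
Qed.

Lemma root_support_rook X : in_ua blk X -> monomial X -> rook_placement (root_support X).
Proof.
move=> uX mX; split=> [a|a b]; first by rewrite inE => /andP [].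
rewrite !support_twins //; case: a b => [i j] [i' j'] /= n1 n2.
split=> e; rewrite e in n1 *; first by rewrite (mX _ _ _ n1 n2).
by rewrite (monomial_col uX mX n1 n2).
Qed.

Lemma calX_support D phi : {in D, forall a, root_ua blk a} ->
  {in D, forall a, phi a != 0} -> root_support (calX blk D phi) = D.
Proof.
move=> rD nD; have uX := calX_ua phi rD; apply/setP => a; rewrite inE.
apply/andP/idP => [[ra nz]|aD].
  have rua : root_ua blk a by rewrite /root_ua ra (full_blk_neq uX).
  by move: nz; rewrite full_calX //; case: ifP => //; rewrite eqxx.
have rua := rD _ aD; rewrite full_calX // aD nD //; by case/andP: rua.
Qed.

Lemma calX_neq0 D phi a : {in D, forall a, root_ua blk a} ->
  {in D, forall a, phi a != 0} ->
  (full (calX blk D phi) a.1 a.2 != 0) = (a \in D :|: twins D).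
Proof.
move=> rD nD; rewrite -support_twins; last exact: calX_ua.
by rewrite calX_support.
Qed.

Lemma calX_monomial D phi : {in D, forall a, root_ua blk a} ->
  {in D, forall a, phi a != 0} -> rook_placement D -> monomial (calX blk D phi).
Proof.
move=> rD nD [_ rk] i j j'; rewrite !(calX_neq0 (i, _)) // => d1 d2.
by have [/(_ erefl) [->]] := rk _ _ d1 d2.
Qed.

Lemma diagonal_scaling X (s : 'I_m -> F) : in_alg blk X -> (forall i, s i != 0) ->
  exists Y, same_Ga_orbit blk X Y /\
    forall i j, full Y i j = s i * s (rev_ord j) * full X i j.
Proof.
move=> aX sn; pose A := diag_mx (\row_i s i); pose A' := diag_mx (\row_i (s i)^-1).
have d (M : 'rV[F]_m) i j : blk i != blk j -> diag_mx M i j = 0.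
  by move=> bij; rewrite mxE; case: (eqVneq i j) bij => [->|]; rewrite ?eqxx.
have AA' : A *m A' = 1%:M.
  by apply/matrixP => i j; rewrite mul_diag_mx !mxE mulrnAr divff.
have [Y [oY YE]] := levi_act blkN blk_le (d _) (d _) AA' aX.
exists Y; split=> // i j; rewrite !full_toB YE tr_diag_mx mul_mx_diag mul_diag_mx.
by rewrite !mxE; ring.
Qed.

(* A non-antidiagonal entry is normalized by its row alone: its twin row contains
   no root. *)
Lemma scale_to_calX X psi : in_ua blk X -> monomial X ->
  (forall a, is_root a -> full X a.1 a.2 != 0 ->
     if antidiag a then exists2 s, s != 0 & psi a = s ^+ 2 * full X a.1 a.2
     else psi a != 0) ->
  same_Ga_orbit blk X (calX blk (root_support X) psi).
Proof.
move=> uX mX H.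
have [s sP] : exists s : 'I_m -> F, forall i, [/\ s i != 0,
    forall j, is_root (i, j) -> full X i j != 0 ->
      psi (i, j) = (if antidiag (i, j) then s i ^+ 2 else s i) * full X i j
    & (forall j, full X i j != 0 -> ~~ is_root (i, j)) -> s i = 1].
  apply: (@fin_all_exists _ (fun=> F) (fun i s => [/\ s != 0,
    forall j, is_root (i, j) -> full X i j != 0 ->
      psi (i, j) = (if antidiag (i, j) then s ^+ 2 else s) * full X i j
    & (forall j, full X i j != 0 -> ~~ is_root (i, j)) -> s = 1])) => i.
  have [j /andP [rj nj]|no] := pickP (fun j => is_root (i, j) && (full X i j != 0)).
    have := H (i, j) rj nj; case: ifP => ad.
      move=> [s s0 sE]; exists s; split=> // [j' _ nj'|/(_ _ nj)]; last by rewrite rj.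
      by rewrite (mX _ _ _ nj' nj) ad.
    move=> p0; exists (psi (i, j) / full X i j).
    split=> [|j' _ nj'|/(_ _ nj)]; last by rewrite rj.
      by rewrite mulf_neq0 // invr_eq0.
    by rewrite (mX _ _ _ nj' nj) ad divfK.
  exists 1; split=> //; first exact: oner_neq0.
  by move=> j rj nj; have := no j; rewrite rj nj.
have [Y [oY YE]] := diagonal_scaling (ua_alg uX) (fun i => let: And3 x _ _ := sP i in x).
suff <- : Y = calX blk (root_support X) psi by [].
have uY := same_orbit_ua blkN blk_le uX oY.
apply: ua_ext => //; first by apply: calX_ua; exact: root_support_ua.
move=> [i j] rij; rewrite full_calX //; last exact: root_support_ua.
have /andP [ra _] := rij; rewrite inE ra YE /=.
have [->|nz] := eqVneq (full X i j) 0; first by rewrite mulr0.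
have [_ /(_ _ ra nz) -> _] := sP i; case: ifP => ad.
  by move: ad => /eqP /= ->; rewrite rev_ordK expr2.
have [_ _ ->] := sP (rev_ord j); first by rewrite mulr1.
have nz' : full X (rev_ord j) (rev_ord i) != 0 by rewrite (full_twin_neq0 (i, j)).
move=> k nk; rewrite (mX _ _ _ nk nz'); apply/negP => /(root_twin ra).
by rewrite ad.
Qed.

End Support.

Section RowSign.
Variables (F : fieldType) (t : classical_type) (n : nat).
Variable blk : 'I_(msize t n) -> int.
Hypothesis blkN : forall i, blk (rev_ord i) = - blk i.
Hypothesis blk_mono : forall i j, label i <= label j -> blk i <= blk j.

(** Only the middle block of type C mixes the two signs. Antidiagonal roots of u^a avoid that block,
    so their entries keep their sign when indices are permuted within blocks. *)
Lemma row_sign_blk i : blk i != 0 ->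
  row_sign F i = if is_typeC t && (blk i < 0) then -1 else 1.
Proof.
move=> b0; rewrite /row_sign; have [tC /=|//] := boolP (is_typeC t).
congr (if _ then _ else _); have lr := label_rev_ord i.
have li : (n <= i)%N = (label i < 0).
  move: (tC) (i); rewrite /label; case: t => //= _ p; have := ltn_ord p => /= pm.
  by case: (ltnP p n) => ?; lia.
have l0 : label i != 0.
  move: (tC) (i); rewrite /label; case: t => //= _ p; have := ltn_ord p => /= pm.
  by case: (ltnP p n) => ?; lia.
rewrite li; have := blk_mono (i := i) (j := rev_ord i);
  have := blk_mono (i := rev_ord i) (j := i).
rewrite blkN lr; move: b0 l0; move: (label i) (blk i) => x y; lia.
Qed.

End RowSign.

(** * Normalization of the entries *)

Section FiniteFieldSquares.
Variable F : finFieldType.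

Definition squares : {set F} := [set x ^+ 2 | x : F].

(** Fibres of squaring have at most two elements, and the one over 0 has a single element, which
    makes the inequality strict. *)
Lemma card_squares : (#|F| < 2 * #|squares|)%N.
Proof.
have s0 : 0 \in squares by apply/imsetP; exists 0; rewrite ?expr0n.
have -> : #|F| = (\sum_(s in squares) #|[set x : F | x ^+ 2 == s]|)%N.
  rewrite -sum1_card (partition_big (fun x : F => x ^+ 2) (mem squares)) /=; last first.
    by move=> x _; exact: imset_f.
  by apply: eq_bigr => s _; rewrite -sum1dep_card.
have le2 s : s \in squares -> (#|[set x : F | x ^+ 2 == s]| <= 2)%N.
  move=> /imsetP [y _ ->]; apply: leq_trans (_ : #|[set y; - y]| <= 2)%N.
    apply: subset_leq_card; apply/subsetP => x; rewrite !inE eqf_sqr //.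
  by rewrite cards2; case: (_ != _).
rewrite (bigD1 0) //= (cardsD1 0 squares) s0 mulnDr muln1 -addSn leq_add //.
  rewrite ltnS -[leqRHS](cards1 (0 : F)); apply: subset_leq_card; apply/subsetP => x.
  by rewrite !inE sqrf_eq0.
rewrite mulnC -sum_nat_const (eq_bigl (fun s => s \in squares :\ 0)) => [|s].
  by apply: leq_sum => s /setD1P [_]; exact: le2.
by rewrite !inE andbC.
Qed.

(** Pigeonhole: the squares, and the elements [c - s] with [s] a square, each fill more than half of
    the field. *)
Lemma sum_two_squares (c : F) : exists x y, x ^+ 2 + y ^+ 2 = c.
Proof.
have [/pred0P dis|/pred0Pn [z /andP [/imsetP [x _ ->]]]] :=
    boolP ([disjoint squares & [set c - s | s in squares]]).
  have := cardsUI squares [set c - s | s in squares].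
  have -> : squares :&: [set c - s | s in squares] = set0.
    by apply/setP => z; rewrite !inE; have := dis z.
  rewrite cards0 addn0 [in X in _ = X]addnC card_imset;
    last by move=> a b /(congr1 (fun z => c - z)); rewrite /= !subKr.
  have := subset_leq_card (subsetT (squares :|: [set c - s | s in squares]));
    rewrite cardsT.
  by have := card_squares; move: #|squares| #|_ :|: _| #|F|; lia.
move=> /imsetP [_ /imsetP [y _ ->] e]; exists x, y.
by rewrite e subrK.
Qed.

(** The nonzero squares and their multiples by [delta] are disjoint, and by [card_squares] they are
    numerous enough to exhaust the nonzero elements. *)
Lemma square_class (delta c : F) : delta != 0 -> (forall x, x ^+ 2 != delta) ->
  c != 0 -> exists2 s, s != 0 & s ^+ 2 * c = 1 \/ s ^+ 2 * c = delta.
Proof.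
move=> d0 dns c0; pose S := squares :\ 0; pose T := [set delta * s | s in S].
have dis : S :&: T = set0.
  apply/setP => z; rewrite !inE; apply/negP => /andP [/andP [_ /imsetP [x _ ->]]].
  move=> /imsetP [s /setD1P [yy0 /imsetP [y _ ey]] e]; subst s; rewrite sqrf_eq0 in yy0.
  by have /eqP := dns (x / y); rewrite expr_div_n e mulfK ?sqrf_eq0.
have cS : (#|S|.+1 = #|squares|)%N.
  by rewrite (cardsD1 0 squares) (_ : 0 \in squares) //; apply/imsetP; exists 0;
    rewrite ?expr0n.
have := cardsUI S T; rewrite dis cards0 addn0 card_imset; last exact: mulfI.
move=> cU; have eST : S :|: T = [set~ 0].
  apply/eqP; rewrite eqEcard; apply/andP; split.
    apply/subsetP => z; rewrite !inE => /orP [/andP [] //|/imsetP [s /setD1P [s0 _] ->]].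
    by rewrite mulf_neq0.
  rewrite cardsC1 cU; have := card_squares; move: cS.
  by move: #|S| #|squares| #|F| => x y z; lia.
have /setUP : c \in S :|: T by rewrite eST !inE c0.
move=> [/setD1P [_ /imsetP [y _ e]]|/imsetP [s /setD1P [s0 /imsetP [y _ e]] e2]].
  have y0 : y != 0 by apply: contraNneq c0 => y0; rewrite e y0 expr0n.
  by exists y^-1; rewrite ?invr_eq0 //; left; rewrite e -exprMn mulVf // expr1n.
have y0 : y != 0 by apply: contraNneq s0 => y0; rewrite e y0 expr0n.
exists y^-1; rewrite ?invr_eq0 //; right.
by rewrite e2 e mulrCA -exprMn mulVf // expr1n mulr1.
Qed.

End FiniteFieldSquares.

Section Rotation.
Variables (F : fieldType) (m : nat) (i j : 'I_m).
Hypothesis ij : i != j.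

Definition rotation (x y : F) : 'M[F]_m := \matrix_(r, c)
  if r == i then x *+ (c == i) + y *+ (c == j)
  else if r == j then x *+ (c == j) - y *+ (c == i) else (r == c)%:R.

Lemma rotation_mulE x y (M : 'M[F]_m) r c : (rotation x y *m M) r c =
  if r == i then x * M i c + y * M j c
  else if r == j then x * M j c - y * M i c else M r c.
Proof.
rewrite mxE; have one p (f : 'I_m -> F) z : \sum_q z *+ (q == p) * f q = z * f p.
  rewrite (bigD1 p) //= eqxx big1 ?addr0 // => q /negPf ->; exact: mul0r.
case: ifP => ri; last case: ifP => rj.
- under eq_bigr => q _ do rewrite mxE ri mulrDl.
  by rewrite big_split /= !one.
- under eq_bigr => q _ do rewrite mxE ri rj mulrBl.
  by rewrite sumrB !one.
- under eq_bigr => q _ do rewrite mxE ri rj [r == q]eq_sym.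
  by rewrite one mul1r.
Qed.

Lemma rotation_mul x y x' y' : rotation x y *m rotation x' y' =
  rotation (x * x' - y * y') (x * y' + y * x').
Proof.
have ji : j == i = false by rewrite eq_sym (negPf ij).
apply/matrixP => r c; rewrite rotation_mulE !mxE !eqxx ji !mulrb.
case: ifP => ri; last case: ifP => rj; last by rewrite ri rj.
  by case: (c == i); case: (c == j); rewrite /=; ring.
by case: (c == i); case: (c == j); rewrite /=; ring.
Qed.

Lemma rotation1 : rotation 1 0 = 1%:M.
Proof.
apply/matrixP => r c; rewrite !mxE !mul0rn subr0 addr0.
by case: eqP => [->|_]; [|case: eqP => [->|_] //]; rewrite eq_sym.
Qed.

Lemma rotation_congr x y (B : 'M[F]_m) : B^T = B ->
  (forall c, c != i -> B i c = 0) -> (forall c, c != j -> B j c = 0) -> B i i = B j j ->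
  forall r c, (rotation x y *m B *m (rotation x y)^T) r c =
    if (r == i) || (r == j) then (x ^+ 2 + y ^+ 2) * B r c else B r c.
Proof.
move=> sB Bi Bj Bij r c; have ji : j != i by rewrite eq_sym.
have -> : rotation x y *m B *m (rotation x y)^T = rotation x y *m (rotation x y *m B)^T.
  by rewrite trmx_mul sB mulmxA.
have bji : B j i = 0 by rewrite Bj.
have bij : B i j = 0 by rewrite Bi.
rewrite rotation_mulE ![_^T _ _]mxE !rotation_mulE.
have [->|ri] := eqVneq r i.
  have [->|ci] := eqVneq c i; first by rewrite bij bji -Bij /=; ring.
  rewrite (Bi c ci) /=; have [_|cj] := eqVneq c j; first by rewrite bij bji Bij; ring.
  by rewrite -sB !mxE (Bi c ci) (Bj c cj); ring.
have [->|rj] := eqVneq r j.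
  have [->|ci] := eqVneq c i; first by rewrite bij bji Bij /=; ring.
  have [->|cj] := eqVneq c j; first by rewrite bij bji Bij /=; ring.
  by rewrite /= (Bj c cj) -sB !mxE (Bi c ci) (Bj c cj); ring.
have eir : B i r = 0 by rewrite Bi.
have ejr : B j r = 0 by rewrite Bj.
rewrite /= eir ejr -[in RHS]sB [in RHS]mxE.
by have [->|ci] := eqVneq c i; [|have [->|//] := eqVneq c j]; rewrite ?eir ?ejr; ring.
Qed.

End Rotation.

Section NormalForm.
Variables (F : finFieldType) (delta : F) (t : classical_type) (n l : nat).
Local Notation m := (msize t n).
Variable blk : 'I_m -> int.
Hypothesis blkN : forall i, blk (rev_ord i) = - blk i.
Hypothesis blk_le : forall i, `|blk i| <= l%:Z.
Hypothesis blk_mono : forall i j, label i <= label j -> blk i <= blk j.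
Hypothesis char2 : (2%:R : F) != 0.
Hypothesis delta0 : delta != 0.
Hypothesis delta_ns : forall x : F, x ^+ 2 != delta.
Local Notation rs := (@row_sign F t n).
Implicit Types (X Y : 'M[F]_m * 'M[F]_m) (D : {set 'I_m * 'I_m}) (a b : 'I_m * 'I_m).
Implicit Types phi psi : 'I_m * 'I_m -> F.

(** The stage before deltas are paired off: a block may still hold several. One definition serves
    all types, because types B and D have no antidiagonal roots and the fourth clause then forces
    the value 1. *)
Definition weak_basic D phi := [/\ {in D, forall a, root_ua blk a}, rook_placement D,
  {in D, forall a, phi a = 1 \/ phi a = delta},
  {in D, forall a, phi a = delta -> antidiag a}
  & {in D, forall a, blk a.1 = - blk a.2 -> is_typeC t -> antidiag a}].

Lemma delta_neq1 : delta != 1.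
Proof. by have := delta_ns 1; rewrite expr1n eq_sym. Qed.

Lemma weak_basic_neq0 D phi : weak_basic D phi -> {in D, forall a, phi a != 0}.
Proof. by case=> _ _ v _ _ a /v [->|->] //; exact: oner_neq0. Qed.

Lemma weak_basic_exists X : in_ua blk X -> exists D phi,
  weak_basic D phi /\ same_Ga_orbit blk X (calX blk D phi).
Proof.
move=> uX; have [Y [oY uY sY]] := reduction blkN blk_le char2 uX.
have aX := ua_alg uX.
have nzB i j : full Y i j != 0 -> toB Y i (rev_ord j) != 0.
  by rewrite full_toB; apply: contraNneq => ->; rewrite mulr0.
have mY : monomial Y.
  move=> i j j' n1 n2; apply: rev_ord_inj.
  by have [_ u _] := sY _ _ (in_setT i) (nzB _ _ n1); rewrite (u _ (nzB _ _ n2)).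
(* The representative of the square class of [c]; the value at 0 is a default, as only entries on
   the support matter. *)
have clsP c : exists d, c != 0 -> (d = 1 \/ d = delta) /\ exists2 s, s != 0 & d = s ^+ 2
  * c.
  have [->|c0] := eqVneq c 0; first by exists 0.
  have [s s0 H] := square_class delta0 delta_ns c0.
  by exists (s ^+ 2 * c) => _; split=> //; exists s.
have [cls clsE] := fin_all_exists clsP.
pose psi a := if antidiag a then cls (full Y a.1 a.2) else 1.
exists (root_support Y), psi; split.
  split.
  - exact: root_support_ua.
  - by exact: (root_support_rook char2 uY).
  - move=> a; rewrite inE => /andP [_ nz]; rewrite /psi; case: ifP => _; last by left.
    by have [] := clsE _ nz.
  - move=> a _; rewrite /psi; case: ifP => // _ e; by have := delta_neq1; rewrite -e eqxx.
  - move=> [i j]; rewrite inE /= => /andP [_ nz] bij tC.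
    have [_ _] := sY _ _ (in_setT i) (nzB _ _ nz); rewrite blkN => /(_ tC bij) ->.
    by rewrite /antidiag /= rev_ordK.
apply: (same_orbit_trans blkN aX oY); apply: (scale_to_calX blkN blk_le) => // a _ nz.
rewrite /psi; case: (antidiag a); last exact: oner_neq0.
by have [_ []] := clsE _ nz; move=> s s0 e; exists s.
Qed.

Lemma delta_pair_step D phi a b : is_typeC t -> weak_basic D phi ->
  a \in D -> b \in D -> a != b -> phi a = delta -> phi b = delta -> blk a.1 = blk b.1 ->
  same_Ga_orbit blk (calX blk D phi)
    (calX blk D (fun c => if (c == a) || (c == b) then 1 else phi c)).
Proof.
move=> tC wb aD bD ab pa pb bab; have [rD rk _ ad _] := wb; have nz := weak_basic_neq0 wb.
have ada := ad _ aD pa; have adb := ad _ bD pb.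
have := rD _ aD; have := rD _ bD.
move: a b aD bD ab pa pb bab ada adb => [i i'] [j j'] aD bD ab pa pb /= bij /eqP /= ei
  /eqP /= ej.
rewrite {}ei {}ej in aD bD ab pa pb *;
  rewrite /root_ua /= !blkN => /andP [_ bj] /andP [_ bi].
have bi0 : blk i != 0 by move: bi; lia.
have ij : i != j by apply: contraNneq ab => ->.
set X := calX blk D phi; have uX : in_ua blk X := calX_ua blkN phi rD.
have mX : monomial X := calX_monomial blkN char2 rD nz rk.
have sX : (toB X)^T = toB X.
  by apply/matrixP => r c; rewrite mxE (toB_sym blkN blk_le r c) // /form_sign tC mul1r.
have val k : (k, rev_ord k) \in D -> phi (k, rev_ord k) = delta -> full X k (rev_ord k) =
  delta.
  by move=> kD pk; rewrite (full_calX phi rD (rD _ kD)) kD.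
have row k : (k, rev_ord k) \in D -> phi (k, rev_ord k) = delta -> forall c, c != k ->
  toB X k c = 0.
  move=> kD pk c; apply: contraNeq; rewrite mxE mulf_eq0 negb_or => /andP [_ nc].
  by apply/eqP; apply: rev_ord_inj; apply: (mX _ _ _ nc); rewrite val.
have [x [y xy]] := sum_two_squares delta^-1.
have rd : forall z w r c, blk r != blk c -> rotation i j z w r c = 0 :> F.
  move=> z w r c brc; rewrite mxE.
  have h p q : blk p = blk q -> (r == p) && (c == q) = false.
    by move=> e; apply: contraNF brc => /andP [/eqP -> /eqP ->]; rewrite e.
  have h1 := h i i erefl; have h2 := h i j bij; have h3 := h j j erefl;
    have h4 := h j i (esym bij).
  case ri: (r == i) h1 h2 => /= h1 h2; first by rewrite h1 h2 addr0.
  case rj: (r == j) h3 h4 => /= h3 h4; first by rewrite h3 h4 subr0.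
  by case: (eqVneq r c) brc => // ->; rewrite eqxx.
(* The inverse is the conjugate (x, -y) divided by the norm 1/delta. *)
have inv : rotation i j x y *m rotation i j (delta * x) (- (delta * y)) = 1%:M.
  rewrite rotation_mul // -(rotation1 F i j); congr rotation; last by ring.
  by transitivity (delta * (x ^+ 2 + y ^+ 2)); [ring | rewrite xy divff].
have [Y [oY YE]] := levi_act blkN blk_le (rd _ _) (rd _ _) inv (ua_alg uX).
have uY := same_orbit_ua blkN blk_le uX oY.
suff <- : Y = calX blk D (fun c => if (c == (i, rev_ord i)) || (c == (j, rev_ord j)) then
  1 else phi c).
  by [].
apply: ua_ext => //; first exact: calX_ua.
move=> [r c] rc; rewrite full_calX //= full_toB YE rotation_congr //; first last.
(* [rotation_congr] needs equal diagonal entries in the form: both are delta up to the row sign,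
   which is common to the block. *)
- by rewrite [LHS]mxE [RHS]mxE (val _ aD pa) (val _ bD pb) !(row_sign_blk F blkN
  blk_mono) -?bij.
- exact: row.
- exact: row.
have -> : forall z, (if (r == i) || (r == j) then (x ^+ 2 + y ^+ 2) * z else z)
    = (if (r == i) || (r == j) then delta^-1 else 1) * z.
  by move=> z; rewrite xy; case: ifP; rewrite ?mul1r.
rewrite mulrCA -full_toB (full_calX phi rD rc) /= !xpair_eqE.
have un k : (k, rev_ord k) \in D -> phi (k, rev_ord k) = delta -> (k, c) \in D -> c =
  rev_ord k.
  move=> kD pk cD; apply: (mX k); rewrite ?val //.
  by rewrite (full_calX phi rD (rD _ cD)) cD nz.
case rcD: ((r, c) \in D); last by rewrite mulr0.
have [ri|ri] := eqVneq r i.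
  by rewrite ri in rcD *; rewrite (un _ aD pa rcD) eqxx pa mulVf.
have [rj|rj] := eqVneq r j; last by rewrite mul1r.
by rewrite rj in rcD *; rewrite (un _ bD pb rcD) eqxx pb mulVf.
Qed.

Lemma basic_exists X : in_ua blk X -> exists D phi,
  basic_pair blk delta D phi /\ same_Ga_orbit blk X (calX blk D phi).
Proof.
move=> uX; have aX := ua_alg uX; have [D [phi [wb oX]]] := weak_basic_exists uX.
case tC: (is_typeC t); last first.
  have [rD rk v ad _] := wb; exists D, phi; split=> //; split=> //; rewrite tC => a aD.
  have [//|/(ad _ aD) aa] := v _ aD; have /andP [] := rD _ aD.
  by rewrite antidiag_root // tC.
have [N] := ubnP #|[set a in D | phi a == delta]|.
elim: N phi wb oX => // N IH phi wb oX cN; have [rD rk v ad kD] := wb.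
pose bad (p : ('I_m * 'I_m) * ('I_m * 'I_m)) :=
  [&& p.1 \in D, p.2 \in D, p.1 != p.2, phi p.1 == delta, phi p.2 == delta & blk p.1.1 ==
    blk p.2.1].
have [[a b] /and5P [/= aD bD ab /eqP pa /andP [/eqP pb /eqP bab]]|good] := pickP bad.
  have st := delta_pair_step tC wb aD bD ab pa pb bab.
  move: st; set phi' := (fun c => _) => st.
  apply: (IH phi'); last 1 first.
  - rewrite ltnS in cN; apply: leq_trans cN; apply: proper_card; apply/properP; split.
      apply/subsetP => c; rewrite !inE /phi' => /andP [-> /=].
      by case: ifP => // _ /eqP e; have := delta_neq1; rewrite -e eqxx.
    exists a; first by rewrite inE aD pa eqxx.
    by rewrite inE aD /phi' eqxx /= eq_sym delta_neq1.
  - split=> // c cD; rewrite /phi'; first by case: ifP => _; [left | exact: v].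
    case: ifP => _; last exact: ad.
    by move=> e; have := delta_neq1; rewrite -e eqxx.
  - exact: (same_orbit_trans blkN aX) oX st.
exists D, phi; split=> //; split=> //; rewrite tC; split=> // k; split.
  by move=> a aD b1 b2; apply: kD => //; rewrite b1 b2 opprK.
rewrite leqNgt; apply/negP => /card_gt1P [a [b [+ + ab]]].
rewrite !inE => /and4P [aD /eqP a1 _ pa] /and4P [bD /eqP b1 _ pb].
by have := good (a, b); rewrite /bad /= aD bD ab pa pb a1 b1 eqxx.
Qed.

End NormalForm.

(** * The Weyl group of the Levi factor *)

Section WeylOrbit.
Variables (F : finFieldType) (delta : F) (t : classical_type) (n l : nat).
Local Notation m := (msize t n).
Variable blk : 'I_m -> int.
Hypothesis blkN : forall i, blk (rev_ord i) = - blk i.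
Hypothesis blk_le : forall i, `|blk i| <= l%:Z.
Hypothesis blk_mono : forall i j, label i <= label j -> blk i <= blk j.
Hypothesis char2 : (2%:R : F) != 0.
Hypothesis delta0 : delta != 0.
Implicit Types (D : {set 'I_m * 'I_m}) (a b : 'I_m * 'I_m) (w : 'S_m).
Implicit Types phi psi : 'I_m * 'I_m -> F.

Lemma basic_root D phi : basic_pair blk delta D phi -> {in D, forall a, root_ua blk a}.
Proof. by case. Qed.

Lemma basic_rook D phi : basic_pair blk delta D phi -> rook_placement D.
Proof. by case. Qed.

Lemma basic_neq0 D phi : basic_pair blk delta D phi -> {in D, forall a, phi a != 0}.
Proof.
case=> _ _; case: ifP => _.
  by move=> [H _ _] a aD; case: (H _ aD) => ->; rewrite ?oner_neq0.
by move=> H a aD; rewrite H // oner_neq0.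
Qed.

Lemma root_mem_twins D b : {in D, forall a, is_root a} -> is_root b ->
  (b \in D :|: twins D) = (b \in D).
Proof.
move=> rD rb; rewrite in_setU; case bD: (b \in D) => //=.
apply: contraFF bD => /imsetP [a aD e]; have ra := rD _ aD; rewrite e in rb *.
by have := root_twin ra rb; rewrite antidiag_twin => /eqP ->.
Qed.

Lemma Weyl_pair_inj w : injective (@Weyl_pair t n w).
Proof.
move=> [i j] [i' j'] /eqP; rewrite xpair_eqE /= !(inj_eq rev_ord_inj, inj_eq perm_inj).
by move=> /andP [/eqP -> /eqP ->].
Qed.

Lemma antidiag_Weyl w a : antidiag (Weyl_pair w a) = antidiag a.
Proof.
case: a => i j; rewrite /antidiag /Weyl_pair /= (inj_eq rev_ord_inj) (inj_eq perm_inj).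
by apply/eqP/eqP => [<-|->]; rewrite rev_ordK.
Qed.

Lemma antidiag_mem_twins D a : antidiag a -> (a \in D :|: twins D) = (a \in D).
Proof.
rewrite antidiag_twin => /eqP ta; rewrite in_setU.
have -> : (a \in twins D) = (a \in D).
  by rewrite -{1}ta mem_imset //; exact: (can_inj (@twinK t n)).
by rewrite orbb.
Qed.

Lemma antidiag_blk a : root_ua blk a -> antidiag a -> blk a.1 != 0.
Proof. by case/andP => _ b /eqP e; move: b; rewrite e blkN; apply: contraNneq => ->;
  rewrite oppr0. Qed.

(** The permutation matrix of [w] lies in the Levi factor and yields the support of [D1], but it may
    disturb signs, and [D1] may contain the twin of an image. The torus repairs this off the
    antidiagonal. On the antidiagonal it could only correct by squares, but there the entries
    already agree. *)
Lemma Weyl_orbit w D phi D1 phi1 : w \in Weyl_L blk ->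
  {in D, forall a, root_ua blk a} -> rook_placement D -> {in D, forall a, phi a != 0} ->
  {in D1, forall a, phi1 a != 0} -> Weyl_act_rel w D phi D1 phi1 ->
  same_Ga_orbit blk (calX blk D phi) (calX blk D1 phi1).
Proof.
move=> wL rD rk nD nD1 [rk1 DD1 p1 _].
have wb i : blk (w i) = blk i by apply/eqP; move: wL; rewrite inE => /forallP.
have wVb i : blk ((w^-1)%g i) = blk i by rewrite -[in RHS](permKV w i) wb.
set X := calX blk D phi; have uX : in_ua blk X by exact: calX_ua.
have pd (s : 'S_m) : (forall i, blk (s i) = blk i) ->
    forall i j, blk i != blk j -> perm_mx s i j = 0 :> F.
  by move=> sb i j bij; rewrite !mxE; case: (eqVneq (s i) j) bij => // <-; rewrite sb eqxx.
have inv : perm_mx (w^-1)%g *m perm_mx w = 1%:M :> 'M[F]_m.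
  by rewrite -perm_mxM mulVg perm_mx1.
have [Y [oY YE]] := levi_act blkN blk_le (pd _ wVb) (pd _ wb) inv (ua_alg uX).
have uY := same_orbit_ua blkN blk_le uX oY.
have {}YE i k : toB Y (w i) (w k) = toB X i k.
  rewrite YE tr_perm_mx -row_permE -col_permE.
  by rewrite 2![LHS]mxE !permK.
have wE i j : (full Y (Weyl_pair w (i, j)).1 (Weyl_pair w (i, j)).2 != 0) = (full X i j
  != 0).
  by rewrite /Weyl_pair /= !full_toB rev_ordK YE !mulf_eq0 !(negPf (row_sign_neq0 F _)).
have sY b : (full Y b.1 b.2 != 0) = (b \in D1 :|: twins D1).
  have [a ->] : exists a, b = Weyl_pair w a.
    exists ((w^-1)%g b.1, rev_ord ((w^-1)%g (rev_ord b.2))).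
    by rewrite /Weyl_pair /= rev_ordK !permKV rev_ordK; case: b.
  rewrite [a]surjective_pairing wE -surjective_pairing DD1 mem_imset;
    last exact: Weyl_pair_inj.
  by rewrite (calX_neq0 blkN char2).
have r1 := rk1.1.
have sD1 : root_support Y = D1.
  apply/setP => b; rewrite inE sY; apply/andP/idP => [[rb]|bD1].
    by rewrite root_mem_twins.
  by rewrite root_mem_twins ?bD1 ?r1.
have mX := calX_monomial blkN char2 rD nD rk.
have mY : monomial Y.
  move=> i j j'; rewrite -[i](permKV w) -[j]rev_ordK -[j']rev_ordK.
  rewrite -[rev_ord j](permKV w) -[rev_ord j'](permKV w).
  set i1 := (w^-1)%g i; set j1 := (w^-1)%g (rev_ord j); set j2 := (w^-1)%g (rev_ord j').
  have := wE i1 (rev_ord j1); have := wE i1 (rev_ord j2);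
    rewrite /Weyl_pair /= !rev_ordK => -> ->.
  by move=> n1 n2; rewrite (rev_ord_inj (mX _ _ _ n1 n2)).
rewrite -sD1; apply: (same_orbit_trans blkN (ua_alg uX) oY).
apply: (scale_to_calX blkN blk_le char2 uY mY) => b rb.
rewrite sY root_mem_twins // => bD1; case ab: (antidiag b); last exact: nD1.
have : b \in D1 :|: twins D1 by rewrite in_setU bD1.
rewrite DD1 => /imsetP [a aD e]; rewrite e antidiag_Weyl in ab.
rewrite antidiag_mem_twins // in aD; exists 1; first exact: oner_neq0.
have bb := antidiag_blk (rD _ aD) ab.
rewrite expr1n mul1r e p1 // -[phi a](_ : full X a.1 a.2 = _); last first.
  by rewrite (full_calX phi rD (rD _ aD)) aD.
move: bb ab; case: (a) => i j /= bb /eqP /= ->; rewrite !full_toB !rev_ordK YE.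
by rewrite !(row_sign_blk F blkN blk_mono) ?wb.
Qed.

End WeylOrbit.

(** Turns equal multisets of invariants into a positionwise matching of the objects that carry
    them. *)
Lemma perm_eq_map_align (T S : eqType) (U : eqType) (f : T -> U) (g : S -> U)
    (s : seq T) (s' : seq S) : perm_eq (map f s) (map g s') ->
  exists2 r, perm_eq r s' & map f s = map g r.
Proof.
case: s' => [|y s1] p.
  by exists [::] => //; case: s p => // x s /perm_size.
set s' := y :: s1 in p *.
have /(perm_iotaP (g y)) [Is pI e] := p; exists [seq nth y s' i | i <- Is].
  have := perm_map (nth y s') pI; rewrite size_map => /permPl ->.
  by rewrite -/(mkseq _ _) mkseq_nth.
rewrite e -map_comp; apply/eq_in_map => i.
by rewrite (perm_mem pI) mem_iota size_map add0n => /andP [_ lt]; exact: nth_map.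
Qed.

(** The complements of [r] and [r'] have the same multiset of values, since those of the whole type
    cancel; aligning them completes the partial bijection. *)
Lemma perm_extension (T : finType) (U : eqType) (f : T -> U) (r r' : seq T) :
  uniq r -> uniq r' -> map f r = map f r' ->
  exists2 w : {perm T}, (forall x, f (w x) = f x) & map w r = r'.
Proof.
move=> ur ur' e.
have full (q : seq T) : uniq q -> perm_eq (q ++ [seq x <- enum T | x \notin q]) (enum T).
  move=> uq; apply: uniq_perm; rewrite ?enum_uniq //.
    rewrite cat_uniq uq filter_uniq ?enum_uniq // andbT.
    by apply/hasPn => x; rewrite mem_filter => /andP [].
  by move=> x; rewrite mem_cat mem_filter mem_enum inE andbT; case: (x \in q).
set c := [seq x <- enum T | x \notin r]; set c' := [seq x <- enum T | x \notin r'].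
have : perm_eq (map f c) (map f c').
  rewrite -(perm_cat2l (map f r)) {2}e -!map_cat; apply: perm_map.
  by rewrite (permPl (full _ ur)) perm_sym full.
case/perm_eq_map_align => c2 pc ec.
have p1 : perm_eq (r ++ c) (enum T) by exact: full.
have p2 : perm_eq (r' ++ c2) (enum T).
  by apply: perm_trans (full _ ur'); rewrite perm_cat2l.
have sz : size (r ++ c) = size (r' ++ c2) by rewrite (perm_size p1) (perm_size p2).
have in1 x : x \in r ++ c by rewrite (perm_mem p1) mem_enum.
have u1 : uniq (r ++ c) by rewrite (perm_uniq p1) enum_uniq.
have u2 : uniq (r' ++ c2) by rewrite (perm_uniq p2) enum_uniq.
have fe : map f (r ++ c) = map f (r' ++ c2) by rewrite !map_cat e ec.
pose w x := nth x (r' ++ c2) (index x (r ++ c)).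
have ix x : (index x (r ++ c) < size (r' ++ c2))%N by rewrite -sz index_mem.
have winj : injective w.
  move=> x y; rewrite /w (set_nth_default y) // => /eqP.
  rewrite nth_uniq // => /eqP h; rewrite -(nth_index x (in1 x)) h.
  by rewrite (set_nth_default y) ?nth_index // index_mem.
exists (perm winj) => [x|].
  rewrite permE /w -(nth_map x (f x)) // -fe (nth_map x) ?index_mem //.
  by rewrite nth_index.
have sr : size r = size r' by rewrite -(size_map f r) e size_map.
have [r0|[x0 _]] : r = [::] \/ exists x, x \in r.
    by case: (r) => [|x q]; [left | right; exists x; rewrite mem_head].
  by rewrite r0 in sr *; case: (r') sr.
apply: (@eq_from_nth _ x0); rewrite size_map // => i ir.
rewrite (nth_map x0) // permE /w index_cat mem_nth // index_uniq //.
rewrite nth_cat -sr ir; apply: set_nth_default; by rewrite -sr.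
Qed.

Section WeylFromClasses.
Variables (F : fieldType) (t : classical_type) (n : nat).
Local Notation m := (msize t n).
Variable blk : 'I_m -> int.
Hypothesis blkN : forall i, blk (rev_ord i) = - blk i.
Implicit Types (D : {set 'I_m * 'I_m}) (a b : 'I_m * 'I_m) (w : 'S_m).
Implicit Types phi psi : 'I_m * 'I_m -> F.

(** The invariants of a single rook under [Weyl_L]. A constant [phi] disregards the labels. *)
Definition root_class phi a := ((blk a.1, blk a.2), (antidiag a, phi a)).

Lemma Weyl_pair_twin w a : Weyl_pair w (twin a) = twin (Weyl_pair w a).
Proof. by rewrite /Weyl_pair /twin /= !rev_ordK. Qed.

(** A rook (i, j) constrains a Weyl element at i and at -j. The two indices coincide exactly on the
    antidiagonal, whence the filter. *)
Lemma uniq_rows D (s : seq ('I_m * 'I_m)) : rook_placement D -> uniq s ->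
  {subset s <= D} ->
  uniq ([seq a.1 | a <- s] ++ [seq rev_ord a.2 | a <- s & ~~ antidiag a]).
Proof.
move=> [rD rk] us sD; have inD a : a \in s -> a \in D :|: twins D.
  by move=> /sD aD; rewrite in_setU aD.
rewrite cat_uniq !map_inj_in_uniq ?filter_uniq //.
- rewrite us /= andbT; apply/hasPn => i /mapP [b]; rewrite mem_filter => /andP [nb bs] ->.
  apply/mapP => -[a as_ e]; case/negP: nb.
  have tb : twin b \in D :|: twins D by rewrite in_setU imset_f ?orbT ?sD.
  have [/(_ (esym e)) ab _] := rk _ _ (inD _ as_) tb.
  by apply: root_twin; [exact: (rD _ (sD _ bs)) | rewrite -ab; exact: (rD _ (sD _ as_))].
- move=> a b; rewrite !mem_filter => /andP [_ /inD aD] /andP [_ /inD bD] /rev_ord_inj e.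
  by have [_ ->] := rk _ _ aD bD.
- by move=> a b /inD aD /inD bD e; have [->] := rk _ _ aD bD.
Qed.

Lemma Weyl_from_classes D phi D' phi' : rook_placement D -> rook_placement D' ->
  {in D', forall a, ~~ antidiag a -> phi' a = 1} ->
  perm_eq [seq root_class phi a | a <- enum D] [seq root_class phi' a | a <- enum D'] ->
  exists w, w \in Weyl_L blk /\ Weyl_act_rel w D phi D' phi'.
Proof.
move=> rk rk' p1 /perm_eq_map_align [s' ps' e].
have szs : size s' = size (enum D) by rewrite -(size_map (root_class phi')) -e size_map.
set s := enum D in e szs; pose p := zip s s'.
have u1 : unzip1 p = s by rewrite unzip1_zip // szs.
have u2 : unzip2 p = s' by rewrite unzip2_zip // szs.
have cls x : x \in p -> root_class phi x.1 = root_class phi' x.2.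
  have : map (fun x => root_class phi x.1) p = map (fun x => root_class phi' x.2) p.
    by rewrite (map_comp (root_class phi) fst) (map_comp (root_class phi') snd) -/(unzip1
      _) -/(unzip2 _) u1 u2.
  by move/eq_in_map; apply.
have sD : {subset s <= D} by move=> x; rewrite mem_enum.
have sD' : {subset s' <= D'} by move=> x; rewrite (perm_mem ps') mem_enum.
have us : uniq s by exact: enum_uniq.
have us' : uniq s' by rewrite (perm_uniq ps') enum_uniq.
(* [w] has to send [r] to [r'] position by position. Both filters test the first component so that
   the lists stay aligned; matched rooks agree on [antidiag] anyway. *)
pose r := [seq x.1.1 | x <- p] ++ [seq rev_ord x.1.2 | x <- p & ~~ antidiag x.1].
pose r' := [seq x.2.1 | x <- p] ++ [seq rev_ord x.2.2 | x <- p & ~~ antidiag x.1].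
have ur : uniq r.
  have := uniq_rows rk us sD; rewrite -u1 /unzip1 filter_map -!map_comp.
  exact.
have ur' : uniq r'.
  have := uniq_rows rk' us' sD'; rewrite -u2 /unzip2 filter_map -!map_comp.
  rewrite (@eq_in_filter _ (preim snd (fun a => ~~ antidiag a)) (fun x => ~~ antidiag x.1)).
    exact.
  by move=> x xp /=; have [_ _ -> _] := cls x xp.
have be : map blk r = map blk r'.
  rewrite !map_cat -!map_comp; congr (_ ++ _); apply/eq_in_map => x.
    by move=> /cls [b _ _ _] /=.
  by rewrite mem_filter => /andP [_ /cls [_ b _ _]] /=; rewrite !blkN b.
have [w wb wr] := perm_extension ur ur' be.
exists w; split; first by rewrite inE; apply/forallP => i; rewrite wb.
have /eqP := wr; rewrite map_cat eqseq_cat ?size_map // -!map_comp => /andP [/eqP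
  /eq_in_map h1 /eqP /eq_in_map h2].
have wp x : x \in p -> Weyl_pair w x.1 = x.2.
  move=> xp; have /= e1 := h1 x xp; have [_ _ ea _] := cls x xp.
  rewrite /Weyl_pair e1; case: (boolP (antidiag x.1)) => ax.
    have ax2 : antidiag x.2 by rewrite -ea.
    rewrite (eqP ax) rev_ordK e1 -(eqP ax2); by case: (x.2).
  have /h2 /= -> : x \in [seq x <- p | ~~ antidiag x.1] by rewrite mem_filter ax.
  by rewrite rev_ordK; case: (x.2).
have mem1 a : a \in D -> exists2 x, x \in p & x.1 = a.
  rewrite -mem_enum -/s -u1 => /mapP [x xp ->]; by exists x.
have mem2 b : b \in D' -> exists2 x, x \in p & x.2 = b.
  rewrite -mem_enum -(perm_mem ps') -u2 => /mapP [x xp ->]; by exists x.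
have pin x : x \in p -> x.1 \in D /\ x.2 \in D'.
  by move=> xp; split; [apply: sD; rewrite -u1 | apply: sD'; rewrite -u2]; exact: map_f.
have imD : [set Weyl_pair w a | a in D] = D'.
  apply/setP => b; apply/imsetP/idP => [[a /mem1 [x xp <-] ->]|/mem2 [x xp <-]].
    by rewrite wp //; have [] := pin x xp.
  by exists x.1; [have [] := pin x xp | rewrite wp].
split=> //.
- rewrite imsetU imD; congr (_ :|: _); rewrite /twins -imD -!imset_comp.
  by apply: eq_imset => a /=; rewrite Weyl_pair_twin.
- by move=> a /mem1 [x xp <-] _; rewrite wp //; have [_ _ _ ->] := cls x xp.
- move=> b bD nb; apply: p1 => //; apply: contra nb => ab.
  have [x xp xb] := mem2 _ bD; have [_ _ ea _] := cls x xp.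
  by rewrite -xb -wp //; apply: imset_f; rewrite inE (pin x xp).1 /= ea xb.
Qed.

End WeylFromClasses.

(** * Rank invariants of arcs *)

Section Arcs.
Variable l : nat.
Local Notation K := ((2 * l + 1)%N%:Z).
Local Notation D := (cdist l).
Implicit Types x y z k : int.

(* The blocks k, x, y, k' occur in this order within one turn of the cycle. *)
Definition arc k k' x y := D k x + D x y + D y k' == D k k'.

Lemma cdist_bound x y : `|x| <= l%:Z -> `|y| <= l%:Z -> 0 <= D x y < K.
Proof. by move=> ? ?; apply/andP; split; cdist_lia. Qed.

Lemma cdist_tri x y z : D x y + D y z = D x z \/ D x y + D y z = D x z + K.
Proof.
rewrite /cdist; case: (ltP x y) => ?; case: (ltP y z) => ?; case: (ltP x z) => ?; lia.
Qed.

(** A term of the truncated product survives on the arc exactly when both of its factors lie on the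
    arc. This is why restriction to an arc is multiplicative. *)
Lemma arc_split k k' x y z : `|k| <= l%:Z -> `|k'| <= l%:Z -> `|x| <= l%:Z ->
  `|y| <= l%:Z -> `|z| <= l%:Z ->
  arc k k' x y && (D x z + D z y < K) = arc k k' x z && arc k k' z y.
Proof.
move=> bk bk' bx b_y bz.
have := (cdist_tri x z y, cdist_tri k x z, cdist_tri z y k', cdist_tri k x k', cdist_tri
  k z k').
have := (cdist_bound bk bx, cdist_bound bx b_y, cdist_bound b_y bk', cdist_bound bk bk').
have := (cdist_bound bx bz, cdist_bound bz b_y, cdist_bound bz bk', cdist_bound bk bz).
rewrite /arc; move: (D x z) (D z y) (D x y) (D k x) (D k z) (D y k') (D z k') (D k k') (D
  x k').
move=> xz zy xy kx kz yk zk kk xk [[[b1 b2] b3] b4] [[[b5 b6] b7] b8] [[[[t1 t2] t3] t4]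
  t5].
apply/andP/andP => -[/eqP e1]; [move=> e2|move=> /eqP e2]; split; try (apply/eqP); lia.
Qed.

Lemma arc_refl k k' : arc k k' k k'.
Proof. by rewrite /arc /cdist !ltxx !subrr !add0r addr0. Qed.

(** The measure for the induction over arcs: on a subarc with other ends, at least one of the two
    end distances is positive. *)
Lemma arc_lt k k' x y : `|k| <= l%:Z -> `|k'| <= l%:Z -> `|x| <= l%:Z ->
  `|y| <= l%:Z -> arc k k' x y -> (x, y) != (k, k') ->
  (`|D x y| < `|D k k'|)%N.
Proof.
move=> bk bk' bx b_y /eqP e ne.
have nz u v : `|u| <= l%:Z -> `|v| <= l%:Z -> D u v = 0 -> u = v.
  by move=> ? ?; cdist_lia.
have [z1|z1] := eqVneq (D k x) 0.
  have [z2|z2] := eqVneq (D y k') 0.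
    by case/eqP: ne; rewrite (nz _ _ bk bx z1) (nz _ _ b_y bk' z2).
  move: e z2; have := cdist_bound bk bx; have := cdist_bound b_y bk';
    have := cdist_bound bx b_y.
  move: (D k x) (D x y) (D y k') (D k k'); lia.
move: e z1; have := cdist_bound bk bx; have := cdist_bound b_y bk';
  have := cdist_bound bx b_y.
move: (D k x) (D x y) (D y k') (D k k'); lia.
Qed.

Lemma arc_opp k x y : arc k (- k) (- y) (- x) = arc k (- k) x y.
Proof.
have o u v : D (- v) (- u) = D u v.
  by rewrite /cdist; rewrite ltrN2; congr (_ + _); ring.
have e : D k (- y) = D y (- k) by rewrite -(o y) opprK.
by rewrite /arc !o e; congr (_ == _); ring.
Qed.

End Arcs.

Section Counting.

Lemma count_enum (T : finType) (A : {set T}) (P : pred T) :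
  count P (enum A) = #|[set a in A | P a]|.
Proof.
rewrite -size_filter cardE; apply: perm_size; apply: uniq_perm.
- by rewrite filter_uniq // enum_uniq.
- exact: enum_uniq.
- by move=> x; rewrite mem_filter !mem_enum inE andbC.
Qed.

(** Inversion over down-sets: by induction on [d] the elements strictly below [k] contribute the
    same [c] to both counts. The comparison at [k] is left as a hypothesis, since it comes from
    equal ranks in one use and from equal parities in another. *)
Lemma count_mem_rec (T : eqType) (le : rel T) (d : T -> nat) (P : pred T) (s s' : seq T) :
  (forall k, le k k) ->
  (forall k x, P k -> P x -> le k x -> x != k -> (d x < d k)%N) ->
  all P s -> all P s' ->
  (forall k c, P k -> count (le k) s = (count_mem k s + c)%N ->
     count (le k) s' = (count_mem k s' + c)%N -> count_mem k s = count_mem k s') ->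
  forall k, count_mem k s = count_mem k s'.
Proof.
move=> le_refl dlt Ps Ps' H k.
have [Pk|nPk] := boolP (P k); last first.
  have z q : all P q -> count_mem k q = 0%N.
    by move=> Pq; apply/count_memPn; apply: contra nPk; exact: (allP Pq).
  by rewrite !z.
move: {2}(d k).+1 (ltnSn (d k)) Pk => N; elim: N k => // N IH k dk Pk.
pose Q := [pred x | le k x && (x != k)].
have cE q : count (le k) q = (count_mem k q + count Q q)%N.
  elim: q => //= x q ->; have [->|_] := eqVneq x k; first by rewrite le_refl; lia.
  by rewrite andbT; lia.
apply: (H k (count Q s)) => //; rewrite cE; congr (_ + _)%N.
rewrite -!size_filter; apply: perm_size; apply/allP => x.
rewrite mem_cat !mem_filter -andb_orr => /andP [Qx /orP xs].
have Px : P x by case: xs; [exact: (allP Ps') | exact: (allP Ps)].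
have fE q : count_mem x (filter Q q) = count_mem x q.
  rewrite count_filter; apply: eq_count => y /=; case: eqP => // ->; exact: Qx.
rewrite /= -/(count_mem x _) !fE; apply/eqP; symmetry; apply: IH => //.
by case/andP: Qx => lx nx; have := dlt _ _ Pk Px lx nx; move: dk; lia.
Qed.

Lemma perm_eq_count_mem (T : eqType) (s s' : seq T) :
  (forall x, count_mem x s = count_mem x s') -> perm_eq s s'.
Proof. by move=> H; apply/allP => x _; apply/eqP. Qed.

End Counting.

(** [M] factors through the set of its nonzero positions, which bounds the rank from above;
    selecting the rows and columns of these positions gives an invertible diagonal matrix, which
    bounds it from below. *)
Lemma rank_monomial (F : fieldType) m (M : 'M[F]_m) :
  (forall i j j', M i j != 0 -> M i j' != 0 -> j = j') ->
  (forall i i' j, M i j != 0 -> M i' j != 0 -> i = i') ->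
  \rank M = #|[set a : 'I_m * 'I_m | M a.1 a.2 != 0]|.
Proof.
move=> mr mc; set S := [set a | _].
have nz (s : 'I_#|S|) : M (enum_val s).1 (enum_val s).2 != 0.
  by have := enum_valP s; rewrite inE.
pose A : 'M[F]_(m, #|S|) := \matrix_(i, s) (i == (enum_val s).1)%:R.
pose C : 'M[F]_(#|S|, m) := \matrix_(s, j) (j == (enum_val s).2)%:R.
pose d : 'rV[F]_#|S| := \row_s M (enum_val s).1 (enum_val s).2.
apply/eqP; rewrite eqn_leq; apply/andP; split.
  have -> : M = A *m (diag_mx d *m C).
    apply/matrixP => i j; rewrite mxE mul_diag_mx.
    have [e|Mij] := eqVneq (M i j) 0.
      rewrite e big1 // => s _; rewrite !mxE; case: (eqVneq i _) => [ei|];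
        last by rewrite mul0r.
      case: (eqVneq j _) => [ej|]; last by rewrite !mulr0.
      by have := nz s; rewrite -ei -ej e eqxx.
    have ijS : (i, j) \in S by rewrite inE.
    rewrite (bigD1 (enum_rank_in ijS (i, j))) //= !mxE enum_rankK_in //= !eqxx mul1r mulr1.
    rewrite big1 ?addr0 // => s ns; rewrite !mxE; case: (eqVneq i _) => [ei|];
      last by rewrite mul0r.
    case: (eqVneq j _) => [ej|]; last by rewrite !mulr0.
    case/eqP: ns; apply: enum_val_inj; rewrite enum_rankK_in //.
    by rewrite [LHS]surjective_pairing -ei -ej.
  exact: leq_trans (mxrankM_maxl _ _) (rank_leq_col _).
have e : A^T *m M *m C^T = diag_mx d.
  apply/matrixP => s s'; rewrite !mxE (bigD1 (enum_val s').2) //= big1 => [|j /negPf nj].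
    rewrite !mxE eqxx mulr1 addr0 (bigD1 (enum_val s).1) //= big1 => [|i /negPf ni].
      rewrite !mxE eqxx mul1r addr0; have [->|ss] := eqVneq s s'; first by rewrite mulr1n.
      apply/eqP; apply: contraNT ss => n1; apply/eqP; apply: enum_val_inj.
      rewrite [LHS]surjective_pairing [RHS]surjective_pairing.
      by rewrite (mr _ _ _ n1 (nz s)) (mc _ _ _ n1 (nz s')).
    by rewrite !mxE ni mul0r.
  by rewrite [X in _ * X]mxE [X in _ * X]mxE nj mulr0.
have r : \rank (diag_mx d) = #|S|.
  apply: mxrank_unit; rewrite unitmxE det_diag unitfE.
  by apply/prodf_neq0 => s _; rewrite mxE.
by rewrite -{1}r -e; apply: leq_trans (mxrankM_maxl _ _) (mxrankM_maxr _ _).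
Qed.

Section RankInvariants.
Variables (F : fieldType) (t : classical_type) (n l : nat).
Local Notation m := (msize t n).
Variable blk : 'I_m -> int.
Hypothesis blkN : forall i, blk (rev_ord i) = - blk i.
Hypothesis blk_le : forall i, `|blk i| <= l%:Z.
Implicit Types g h X Y : 'M[F]_m * 'M[F]_m.

Definition arc_part k k' (M : 'M[F]_m) : 'M[F]_m :=
  \matrix_(i, j) (if arc l k k' (blk i) (blk j) then M i j else 0).

Lemma arc_part_mul k k' g h : `|k| <= l%:Z -> `|k'| <= l%:Z ->
  in_alg blk g -> in_alg blk h ->
  arc_part k k' (full (alg_mul blk g h)) =
  arc_part k k' (full g) *m arc_part k k' (full h).
Proof.
move=> bk bk' ag ah; apply/matrixP => i j.
rewrite [LHS]mxE [RHS]mxE (full_mul blk_le) //.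
transitivity (\sum_p if arc l k k' (blk i) (blk j) && (blk_dist l blk i p + blk_dist l
  blk p j < (2 * l + 1)%N%:Z)
   then full g i p * full h p j else 0).
  case: ifP => _; last by rewrite big1.
  by apply: eq_bigr => p _; rewrite /fits /=; case: ltP => _; rewrite ?mul1r ?mul0r.
apply: eq_bigr => p _; rewrite arc_split // ![arc_part _ _ _ _ _]mxE.
by case: (arc _ _ _ (blk i) _); case: (arc _ _ _ _ (blk j)); rewrite /= ?mulr0 ?mul0r.
Qed.

Lemma rank_arc_part k k' X Y : `|k| <= l%:Z -> `|k'| <= l%:Z -> in_alg blk X ->
  same_Ga_orbit blk X Y ->
  \rank (arc_part k k' (full X)) = \rank (arc_part k k' (full Y)).
Proof.
move=> bk bk' aX oXY.
have le X1 Y1 : in_alg blk X1 -> same_Ga_orbit blk X1 Y1 ->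
    (\rank (arc_part k k' (full Y1)) <= \rank (arc_part k k' (full X1)))%N.
  move=> aX1 [g [[ag _] ->]]; have agd := in_alg_dagger blkN ag.
  rewrite /Ga_act !arc_part_mul //; last exact: in_alg_mul.
  exact: leq_trans (mxrankM_maxl _ _) (mxrankM_maxr _ _).
apply/eqP; rewrite eqn_leq; apply/andP; split; apply: le => //.
  exact: (same_orbit_alg blkN aX).
exact: (same_orbit_sym blkN).
Qed.

End RankInvariants.

Section KeyCounts.
Variables (F : finFieldType) (delta : F) (t : classical_type) (n l : nat).
Local Notation m := (msize t n).
Variable blk : 'I_m -> int.
Hypothesis blkN : forall i, blk (rev_ord i) = - blk i.
Hypothesis blk_le : forall i, `|blk i| <= l%:Z.
Hypothesis blk_mono : forall i j, label i <= label j -> blk i <= blk j.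
Hypothesis char2 : (2%:R : F) != 0.
Hypothesis delta0 : delta != 0.
Implicit Types (D : {set 'I_m * 'I_m}) (a b : 'I_m * 'I_m) (w : 'S_m).
Implicit Types phi psi : 'I_m * 'I_m -> F.

Definition key a := (blk a.1, blk a.2).

Lemma rank_arc_calX k k' D phi : basic_pair blk delta D phi ->
  \rank (arc_part l blk k k' (full (calX blk D phi))) =
  #|[set a in D :|: twins D | arc l k k' (blk a.1) (blk a.2)]|.
Proof.
move=> bp; have rD := basic_root bp; have nD := basic_neq0 delta0 bp.
have uX := calX_ua blkN phi rD.
have mX := calX_monomial blkN char2 rD nD (basic_rook bp).
have E i j : arc_part l blk k k' (full (calX blk D phi)) i j != 0 ->
    full (calX blk D phi) i j != 0.
  by rewrite [arc_part _ _ _ _ _ _ _]mxE; case: ifP => //; rewrite eqxx.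
rewrite rank_monomial.
- apply: eq_card => a; rewrite !inE [arc_part _ _ _ _ _ _ _]mxE.
  rewrite -in_setU -(calX_neq0 blkN char2 a rD nD).
  by case: (arc _ _ _ _ _); rewrite ?andbT ?andbF ?eqxx.
- by move=> i j j' /E n1 /E n2; exact: mX n1 n2.
- by move=> i i' j /E n1 /E n2; exact: (monomial_col uX mX n1 n2).
Qed.

Lemma key_counts D phi D' phi' : basic_pair blk delta D phi ->
  basic_pair blk delta D' phi' ->
  same_Ga_orbit blk (calX blk D phi) (calX blk D' phi') ->
  forall x, count_mem x (map key (enum (D :|: twins D))) =
            count_mem x (map key (enum (D' :|: twins D'))).
Proof.
move=> bp bp' o.
have aX : in_alg blk (calX blk D phi) := ua_alg (calX_ua blkN phi (basic_root bp)).
pose P := fun x : int * int => (`|x.1| <= l%:Z) && (`|x.2| <= l%:Z).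
have Pk (A : {set 'I_m * 'I_m}) : all P (map key (enum A)).
  by apply/allP => _ /mapP [a _ ->]; rewrite /P !blk_le.
apply: (count_mem_rec (le := fun x y => arc l x.1 x.2 y.1 y.2)
  (d := fun x => `|cdist l x.1 x.2|%N) (P := P)) => //.
- by move=> x; exact: arc_refl.
- move=> [k k'] [x y] /andP [/= b1 b2] /andP [/= b3 b4] a ne; exact: (arc_lt b1 b2 b3 b4).
move=> [k k'] c /andP [/= b1 b2].
rewrite !(count_map _ _ (enum _)) !count_enum.
have := rank_arc_part blkN blk_le b1 b2 aX o.
rewrite (rank_arc_calX _ _ bp) (rank_arc_calX _ _ bp').
set p := #|_|; set q := #|_| => pq; rewrite -/p.
set r := #|_|; rewrite -/q; set r' := #|_|.
by move: pq; lia.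
Qed.

Lemma root_blk a : is_root a -> 0 <= blk a.1 + blk a.2.
Proof.
case: a => i j /orP [/andP [_ lt]|/andP [_ /eqP /= ->]]; last by rewrite /= blkN subrr.
have := blk_mono (i := rev_ord j) (j := i); rewrite label_rev_ord blkN /=.
by move: lt => /= lt h; have := h _; move: h; clear -lt; lia.
Qed.

(** Ranks count rooks together with their twins. [twin] negates the sum of the two blocks, which is
    nonnegative at roots, so only sum zero is ambiguous: there a rook of type C is its own twin,
    while in types B and D rooks and twins are distinct and share a block pair. *)
Lemma card_key D phi (x : int * int) : basic_pair blk delta D phi ->
  let N := #|[set a in D :|: twins D | key a == x]| in
  #|[set a in D | key a == x]| =
  if x.1 + x.2 < 0 then 0%N else if (0 < x.1 + x.2) || is_typeC t then N else N./2.
Proof.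
move=> bp /=; have rua := basic_root bp.
have rD a : a \in D -> is_root a by move=> /rua /andP [].
have tw a : (a \in twins D) = (twin a \in D).
  by rewrite -{1}[a]twinK mem_imset //; exact: (can_inj (@twinK t n)).
case: ltP => [lt|ge].
  apply/eqP; rewrite cards_eq0; apply/eqP/setP => a; rewrite !inE.
  apply/negP => /andP [aD /eqP e]; have := root_blk (rD _ aD).
  by move: lt; rewrite -e /key /=; lia.
case: ifP => [h|].
  apply: eq_card => a; rewrite !inE tw; case aD: (a \in D) => //=.
  apply/esym/negP => /andP [tD /eqP e]; case/orP: h => [gt|tC].
    have := root_blk (rD _ tD); rewrite /twin /= !blkN.
    by move: gt; rewrite -e /key /=; lia.
  have [//|eq] : 0 < x.1 + x.2 \/ x.1 + x.2 = 0 by move: ge; lia.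
    move=> gt; have := root_blk (rD _ tD); rewrite /twin /= !blkN.
    by move: gt; rewrite -e /key /=; lia.
  have [_ _] := bp; rewrite tC => -[_ _ /(_ (blk (twin a).1)) [+ _]].
  move=> /(_ _ tD erefl); rewrite /twin /= !blkN opprK.
  have -> : - blk a.1 = blk a.2 by move: eq; rewrite -e /key /=; lia.
  move=> /(_ erefl); rewrite -/(twin a) antidiag_twin twinK => /eqP ta.
  by rewrite ta tD in aD.
move/negbT; rewrite negb_or => /andP [gt0 nC].
have x0 : x.1 + x.2 = 0 by move: gt0 ge; lia.
set S := [set a in D | _];
  have -> : [set a in D :|: twins D | key a == x] = S :|: [set twin a | a in S].
  apply/setP => a; rewrite !inE tw.
  have -> : (a \in [set twin a | a in S]) = (twin a \in S).
    by rewrite -{1}[a]twinK mem_imset //; exact: (can_inj (@twinK t n)).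
  rewrite inE andb_orl; congr (_ || (_ && _)).
  rewrite /key /twin /= !blkN; case: (x) x0 => x1 x2 /= x0; rewrite !xpair_eqE.
  by apply/andP/andP => -[/eqP e1 /eqP e2]; split; apply/eqP; move: e1 e2 x0; lia.
rewrite cardsU card_imset; last exact: (can_inj (@twinK t n)).
have -> : S :&: [set twin a | a in S] = set0.
  apply/setP => a; rewrite !inE; apply/negP => /andP [/andP [aD _] /imsetP [b]].
  rewrite inE => /andP [bD _] e; have := root_twin (rD _ bD);
    rewrite -e => /(_ (rD _ aD)) ad.
  by have := rD _ bD; rewrite antidiag_root // (negPf nC).
by rewrite cards0 subn0 addnn doubleK.
Qed.

Lemma key_perm D phi D' phi' : basic_pair blk delta D phi ->
  basic_pair blk delta D' phi' ->
  same_Ga_orbit blk (calX blk D phi) (calX blk D' phi') ->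
  perm_eq (map key (enum D)) (map key (enum D')).
Proof.
move=> bp bp' o; apply: perm_eq_count_mem => x.
rewrite !count_map !count_enum /=.
rewrite (card_key x bp) (card_key x bp').
have := key_counts bp bp' o x; rewrite !count_map !count_enum /= => -> //.
Qed.

End KeyCounts.

(** * Discriminants of symmetric arcs *)

(** [C *m C^T] is diagonal, with the squares of the nonzero entries of [C] on the diagonal. *)
Lemma monomial_det_neq0 (F : fieldType) m (C : 'M[F]_m) :
  (forall i j j', C i j != 0 -> C i j' != 0 -> j = j') ->
  (forall i i' j, C i j != 0 -> C i' j != 0 -> i = i') ->
  (forall i, exists j, C i j != 0) -> \det C != 0.
Proof.
move=> mr mc ex; have CC : C *m C^T = diag_mx (\row_i (\sum_j C i j ^+ 2)).
  apply/matrixP => i i'; rewrite !mxE; have [->|ne] := eqVneq i i'.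
    by rewrite mulr1n; apply: eq_bigr => j _; rewrite mxE expr2.
  rewrite big1 // => j _; rewrite mxE; apply/eqP; apply: contraNT ne.
  by rewrite mulf_eq0 negb_or => /andP [n1 n2]; rewrite (mc _ _ _ n1 n2).
have : \det (C *m C^T) != 0.
  rewrite CC det_diag; apply/prodf_neq0 => i _; rewrite mxE.
  have [j nj] := ex i; rewrite (bigD1 j) //= big1 ?addr0 ?sqrf_eq0 // => k kj.
  apply/eqP; rewrite sqrf_eq0; apply: contraNT kj => nk; apply/eqP.
  exact: mr nk nj.
by rewrite det_mulmx det_tr mulf_eq0 negb_or => /andP [].
Qed.

(* Adding the identity on the complement of T to both forms makes them
   invertible and keeps them congruent, so that determinants can be compared. *)
Lemma congruent_monomial_det (F : fieldType) m (T : {set 'I_m}) (s : 'I_m -> F)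
    (B B' G : 'M[F]_m) :
  (forall i j j', B i j != 0 -> B i j' != 0 -> j = j') ->
  (forall i i' j, B i j != 0 -> B i' j != 0 -> i = i') ->
  (forall i j, B i j != 0 -> (i \in T) && (j \in T)) ->
  (forall i, i \in T -> exists j, B i j != 0) ->
  (forall i j, B' i j = B i j * s j) -> (forall i, i \notin T -> s i = 1) ->
  B' = G *m B *m G^T -> exists c, \prod_i s i = c ^+ 2.
Proof.
move=> mr mc BT Tn B'E s1 B'G.
pose e : 'M[F]_m := diag_mx (\row_i (i \in T)%:R);
  pose f : 'M[F]_m := diag_mx (\row_i (i \notin T)%:R).
have eE M i j : (e *m M) i j = (i \in T)%:R * M i j by rewrite mul_diag_mx !mxE.
have eE' M i j : (M *m e) i j = M i j * (j \in T)%:R by rewrite mul_mx_diag !mxE.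
have fE M i j : (f *m M) i j = (i \notin T)%:R * M i j by rewrite mul_diag_mx !mxE.
have fE' M i j : (M *m f) i j = M i j * (j \notin T)%:R by rewrite mul_mx_diag !mxE.
have Bnz i j : ~~ ((i \in T) && (j \in T)) -> B i j = 0.
  by move=> h; apply/eqP; apply: contraNT h; exact: BT.
have eB : e *m B = B.
  apply/matrixP => i j; rewrite eE; case iT: (i \in T); rewrite ?mul1r //.
  by rewrite Bnz ?iT // mulr0.
have Be : B *m e = B.
  apply/matrixP => i j; rewrite eE'; case jT: (j \in T); rewrite ?mulr1 //.
  by rewrite Bnz ?jT ?andbF // mul0r.
have fB : f *m B = 0.
  apply/matrixP => i j; rewrite fE [RHS]mxE; case iT: (i \in T); rewrite ?mul0r //.
  by rewrite Bnz ?iT // mulr0.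
have Bf : B *m f = 0.
  apply/matrixP => i j; rewrite fE' [RHS]mxE; case jT: (j \in T); rewrite ?mulr0 //.
  by rewrite Bnz ?jT ?andbF // mul0r.
have ef : e *m f = 0.
  by apply/matrixP => i j; rewrite eE !mxE; case: (i \in T); rewrite ?mul0r ?mul0rn ?mulr0.
have fe : f *m e = 0.
  by apply/matrixP => i j; rewrite fE !mxE; case: (i \in T); rewrite ?mul0r ?mul0rn ?mulr0.
have ff : f *m f = f.
  by apply/matrixP => i j; rewrite fE !mxE; case: (i \in T); rewrite ?mul0r ?mul0rn ?mul1r.
have eT : e^T = e by rewrite tr_diag_mx.
have fT : f^T = f by rewrite tr_diag_mx.
have eB'e : e *m B' *m e = B'.
  apply/matrixP => i j; rewrite eE' eE B'E.
  case iT: (i \in T); case jT: (j \in T); rewrite ?mul1r ?mulr1 //;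
  by rewrite Bnz ?iT ?jT // !(mul0r, mulr0).
(* Compressing [G] to [T] loses nothing, as both forms live on [T]; [h] is then a congruence between
   the completed forms, and its determinant is the required [c]. *)
pose h := e *m G *m e + f.
have hC : h *m (B + f) *m h^T = B' + f.
  have -> : h^T = e *m G^T *m e + f by rewrite /h raddfD /= !trmx_mul eT fT mulmxA.
  have -> : h *m (B + f) = e *m G *m B + f.
    rewrite mulmxDl !mulmxDr -(mulmxA _ e B) eB -(mulmxA _ e f) ef mulmx0 addr0.
    by rewrite fB ff add0r.
  rewrite mulmxDl !mulmxDr ff -(mulmxA _ B f) Bf mulmx0 addr0 !mulmxA fe !mul0mx add0r.
  by rewrite -(mulmxA _ B e) Be -[in RHS]eB'e B'G !mulmxA.
have CS : B' + f = (B + f) *m diag_mx (\row_i s i).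
  apply/matrixP => i j; rewrite mul_mx_diag [LHS]mxE [RHS]mxE B'E [(B + f) i j]mxE mulrDl.
  rewrite [(\row_ _ _) _ _]mxE; congr (_ + _).
  have -> : f i j = (i \notin T)%:R *+ (i == j) by rewrite !mxE.
  case: (eqVneq i j) => [->|_]; last by rewrite mulr0n mul0r.
  by case jT: (j \in T); rewrite ?mul0rn ?mul0r // s1 ?jT // mulr1.
have C0 : \det (B + f) != 0.
  have CE i j : (B + f) i j = if i \in T then B i j else (i == j)%:R.
    rewrite !mxE; case iT: (i \in T) => /=; first by rewrite mul0rn addr0.
    by rewrite Bnz ?iT // add0r.
  have dn i j : (i == j)%:R != 0 :> F -> i = j by case: (eqVneq i j) => // _; rewrite eqxx.
  apply: monomial_det_neq0.
  - move=> i j j'; rewrite !CE; case: ifP => _; first exact: mr.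
    by move=> /dn <- /dn.
  - move=> i i' j; rewrite !CE; case: ifP => iT; case: ifP => i'T; first exact: mc.
    + by move=> /BT /andP [_ jT] /dn e1; rewrite e1 jT in i'T.
    + by move=> /dn e1 /BT /andP [_ jT]; rewrite e1 jT in iT.
    + by move=> /dn -> /dn ->.
  - move=> i; case iT: (i \in T); first by have [j nj] := Tn i iT; exists j; rewrite CE iT.
    by exists i; rewrite CE iT eqxx oner_neq0.
exists (\det h); apply: (mulfI C0).
have := congr1 determinant hC; rewrite CS !det_mulmx det_tr det_diag.
under [in X in _ = X -> _]eq_bigr => i _ do rewrite mxE.
by move=> <-; ring.
Qed.

Section DeltaParity.
Variables (F : finFieldType) (delta : F) (t : classical_type) (n l : nat).
Local Notation m := (msize t n).
Variable blk : 'I_m -> int.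
Hypothesis blkN : forall i, blk (rev_ord i) = - blk i.
Hypothesis blk_le : forall i, `|blk i| <= l%:Z.
Hypothesis char2 : (2%:R : F) != 0.
Hypothesis delta0 : delta != 0.
Hypothesis delta_ns : forall x : F, x ^+ 2 != delta.
Hypothesis tC : is_typeC t.
Local Notation rs := (@row_sign F t n).
Implicit Types (D : {set 'I_m * 'I_m}) (a b : 'I_m * 'I_m).
Implicit Types phi psi : 'I_m * 'I_m -> F.

(** The passage of [toB] for a single matrix, to be applied after restriction to an arc. *)
Definition gram (M : 'M[F]_m) : 'M[F]_m := \matrix_(i, k) (rs k * M i (rev_ord k)).

Lemma gram_congr (G P : 'M[F]_m) :
  gram (G *m P *m dagger G) = G *m gram P *m G^T.
Proof.
apply/matrixP => i k; rewrite mxE [(_ *m dagger _) _ _]mxE [RHS]mxE.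
rewrite (reindex_inj rev_ord_inj) /= mulr_sumr; apply: eq_bigr => q _.
rewrite daggerE !rev_ordK [G^T _ _]mxE !row_sign_rev ![(G *m _) _ _]mxE.
set c := if _ then _ else _; have cc : c * c = 1.
  by rewrite /c; case: ifP; rewrite ?mulrNN mul1r.
have sk : rs k * rs k = 1 by exact: row_sign_sq.
rewrite [in RHS](eq_bigr (fun p => rs q * (G i p * P p (rev_ord q)))) => [|p _]; last first.
  by rewrite [gram _ _ _]mxE; ring.
rewrite -mulr_sumr; set S := \sum_(_ < _) _.
transitivity (c * c * (rs k * rs k) * (rs q * S * G k q)); first by ring.
by rewrite cc sk !mul1r.
Qed.

(** [dagger] sends a block pair (x, y) to (-y, -x), and an arc from [k] to [- k] is stable under
    this. *)
Lemma arc_part_dagger k (g : 'M[F]_m * 'M[F]_m) : in_alg blk g ->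
  arc_part l blk k (- k) (full (alg_dagger g)) = dagger (arc_part l blk k (- k) (full g)).
Proof.
move=> ag; apply/matrixP => i j; rewrite daggerE [LHS]mxE full_dagger.
rewrite [arc_part _ _ _ _ _ _ _]mxE !blkN arc_opp.
by case: ifP; rewrite ?mulr0.
Qed.

Lemma nonantidiag_agree D phi psi a : basic_pair blk delta D phi ->
  basic_pair blk delta D psi -> ~~ antidiag a ->
  full (calX blk D phi) a.1 a.2 = full (calX blk D psi) a.1 a.2.
Proof.
move=> bp bq na; have rD := basic_root bp.
have uX := calX_ua blkN phi rD; have uY := calX_ua blkN psi rD.
have one chi b : basic_pair blk delta D chi -> b \in D -> ~~ antidiag b -> chi b = 1.
  move=> [_ _]; rewrite tC => -[v ad _] bD nb; case: (v _ bD) => // /(ad _ bD).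
  by rewrite (negPf nb).
have agree b : root_ua blk b -> ~~ antidiag b ->
    full (calX blk D phi) b.1 b.2 = full (calX blk D psi) b.1 b.2.
  by move=> rb nb; rewrite !full_calX //; case: ifP => // bD; rewrite !(one _ b).
have [bij|bij] := eqVneq (blk a.1) (blk a.2);
  first by rewrite (full_block0 uX) ?(full_block0 uY).
have ij : a.1 != a.2 by apply: contraNneq bij => ->.
case: (rootP ij) => [r|r|_]; last by rewrite tC.
  by apply: agree => //; rewrite /root_ua r.
rewrite -[a.1]rev_ordK -[a.2]rev_ordK (full_skew _ _ uX) (full_skew _ _ uY).
have := agree (twin a); rewrite /root_ua r /twin /= !blkN eqr_opp eq_sym bij => -> //.
by move: na; rewrite !antidiag_twin twinK eq_sym.
Qed.

Definition delta_rows D phi : {set 'I_m} :=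
  [set i | ((i, rev_ord i) \in D) && (phi (i, rev_ord i) == delta)].

(** With a common [D] the two forms on the arc have the same support and differ by factors psi/phi
    on the antidiagonal rooks. The product of these factors is a square, whereas an odd power of
    [delta] is not. *)
Lemma delta_parity D phi psi k : basic_pair blk delta D phi ->
  basic_pair blk delta D psi ->
  same_Ga_orbit blk (calX blk D phi) (calX blk D psi) -> `|k| <= l%:Z ->
  odd #|[set i in delta_rows D phi | arc l k (- k) (blk i) (- blk i)]| =
  odd #|[set i in delta_rows D psi | arc l k (- k) (blk i) (- blk i)]|.
Proof.
move=> bp bq o bk; have rD := basic_root bp; have rk := basic_rook bp.
have np := basic_neq0 delta0 bp; have nq := basic_neq0 delta0 bq.
have bk' : `|- k| <= l%:Z by rewrite normrN.
set X := calX blk D phi in o *; set Y := calX blk D psi in o *.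
have uX : in_ua blk X := calX_ua blkN phi rD; have uY : in_ua blk Y := calX_ua blkN psi rD.
have mX : monomial X := calX_monomial blkN char2 rD np rk.
have XD a : root_ua blk a -> full X a.1 a.2 = if a \in D then phi a else 0 by exact:
  full_calX.
have YD a : root_ua blk a -> full Y a.1 a.2 = if a \in D then psi a else 0 by exact:
  full_calX.
have rad i : blk i != 0 -> root_ua blk (i, rev_ord i).
  move=> b0; rewrite /root_ua antidiag_root ?tC /antidiag //= blkN; move: b0; clear; lia.
have adX i : full X i (rev_ord i) = if (i, rev_ord i) \in D then phi (i, rev_ord i) else 0.
  have [b0|/rad r] := eqVneq (blk i) 0; last exact: (XD (i, rev_ord i)).
  rewrite (full_block0 uX) ?blkN ?b0 ?oppr0 //; case: ifP => // /rD.
  by rewrite /root_ua /= blkN b0 oppr0 eqxx andbF.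
have adY i : full Y i (rev_ord i) = if (i, rev_ord i) \in D then psi (i, rev_ord i) else 0.
  have [b0|/rad r] := eqVneq (blk i) 0; last exact: (YD (i, rev_ord i)).
  rewrite (full_block0 uY) ?blkN ?b0 ?oppr0 //; case: ifP => // /rD.
  by rewrite /root_ua /= blkN b0 oppr0 eqxx andbF.
pose A := [set i | ((i, rev_ord i) \in D) && arc l k (- k) (blk i) (- blk i)].
pose s i := if i \in A then psi (i, rev_ord i) / phi (i, rev_ord i) else 1.
pose P (M : 'M[F]_m * 'M[F]_m) := arc_part l blk k (- k) (full M).
pose B := gram (P X); pose B' := gram (P Y).
pose T := [set i | [exists j, B i j != 0]].
have BE M i j : gram (P M) i j = rs j * (if arc l k (- k) (blk i) (- blk j) then full M i
  (rev_ord j) else 0).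
  by rewrite [LHS]mxE [P M _ _]mxE blkN.
have Bnz i j : B i j != 0 -> arc l k (- k) (blk i) (- blk j) /\ full X i (rev_ord j) != 0.
  by rewrite /B BE mulf_eq0 negb_or => /andP [_]; case: ifP => //; rewrite eqxx.
have Bnz' i j : arc l k (- k) (blk i) (- blk j) -> full X i (rev_ord j) != 0 -> B i j != 0.
  by rewrite /B BE mulf_eq0 negb_or (row_sign_neq0 F) => ->.
have Bsym i j : B i j != 0 -> B j i != 0.
  move=> /Bnz [ar nz]; apply: Bnz'; first by rewrite -arc_opp !opprK.
  by have := full_twin_neq0 (i, rev_ord j) uX; rewrite /twin /= rev_ordK => ->.
have [g [[ag _] YE]] := o; have agd := in_alg_dagger blkN ag; have aX := ua_alg uX.
have B'G : B' = P g *m B *m (P g)^T.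
  rewrite -gram_congr -arc_part_dagger // /B' /P YE /Ga_act !(arc_part_mul blk_le) //.
  exact: in_alg_mul.
have [] := @congruent_monomial_det F m T s B B' (P g) _ _ _ _ _ _ B'G.
- move=> i j j' /Bnz [_ n1] /Bnz [_ n2]; apply: rev_ord_inj; exact: mX n1 n2.
- move=> i i' j /Bnz [_ n1] /Bnz [_ n2]; exact: (monomial_col uX mX n1 n2).
- move=> i j nz; rewrite !inE; apply/andP; split; apply/existsP; first by exists j.
  by exists i; exact: Bsym.
- by move=> i; rewrite inE => /existsP.
- move=> i j; rewrite /B' /B !BE -mulrA; congr (_ * _); case: ifP => ar;
  last by rewrite mul0r.
  have [ij|ij] := eqVneq i j.
    subst j; rewrite adX adY /s inE ar andbT; case: ifP => jD; last by rewrite mul0r.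
    by rewrite mulrCA divff ?mulr1 // np.
  have na : ~~ antidiag (i, rev_ord j) by rewrite /antidiag /= (inj_eq rev_ord_inj) eq_sym.
  have /= <- := nonantidiag_agree bp bq na; rewrite -/X.
  have [->|nz] := eqVneq (full X i (rev_ord j)) 0; first by rewrite mul0r.
  rewrite /s inE; case: ifP => [/andP [jD _]|_]; last by rewrite mulr1.
  case/eqP: ij; apply: (monomial_col uX mX nz); rewrite adX jD; exact: np.
- move=> i; rewrite inE /s => /existsPn no; case: ifP => //; rewrite inE => /andP [iD ar].
  have := no i; rewrite negbK => /eqP Bi; have : B i i != 0.
    by apply: Bnz' => //; rewrite adX iD; exact: np.
  by rewrite Bi eqxx.
move=> c sc.
have prodE chi : basic_pair blk delta D chi ->
    \prod_(i in A) chi (i, rev_ord i) =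
    delta ^+ #|[set i in delta_rows D chi | arc l k (- k) (blk i) (- blk i)]|.
  move=> [_ _]; rewrite tC => -[v _ _].
  rewrite (bigID (fun i => chi (i, rev_ord i) == delta)) /= [X in _ * X]big1 ?mulr1.
    rewrite (eq_bigr (fun=> delta)) => [|i /andP [_ /eqP] //].
    rewrite prodr_const; congr (_ ^+ _); apply: eq_card => i.
    by rewrite !inE unfold_in /= !inE andbAC.
  by move=> i; rewrite inE => /andP [/andP [iD _] nd]; case: (v _ iD) => // e;
    rewrite e eqxx in nd.
have : \prod_(i in A) psi (i, rev_ord i) = c ^+ 2 * \prod_(i in A) phi (i, rev_ord i).
  rewrite -sc big_mkcond [X in _ = _ * X]big_mkcond -big_split /=; apply: eq_bigr => i _.
  rewrite /s; case: ifP => iA; last by rewrite mulr1.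
  by rewrite divfK //; move: iA; rewrite inE => /andP [iD _]; exact: np.
rewrite (prodE _ bp) (prodE _ bq); set p := #|_|; set q := #|_| => e.
(* Modulo squares only the parity of the exponent remains; different parities would exhibit [delta]
   as a square. *)
have sq r : delta ^+ r = delta ^+ (odd r) * (delta ^+ r./2) ^+ 2.
  by rewrite -exprM muln2 -exprD odd_double_half.
have dn r : delta ^+ r != 0 by rewrite expf_neq0.
rewrite (sq p) (sq q) in e.
have Xn := dn p./2; have Yn := dn q./2.
move: (delta ^+ p./2) (delta ^+ q./2) Xn Yn e => x y x0 y0.
case: (odd p); case: (odd q) => //=; rewrite expr1 expr0 mul1r => e.
  by have := delta_ns (c * y / x); rewrite expr_div_n exprMn -e mulfK ?eqxx ?expf_neq0.
have c0 : c != 0.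
  by apply: contraNneq x0 => c0; move/eqP: e; rewrite c0 expr0n mul0r sqrf_eq0.
have := delta_ns (x / (c * y)); rewrite expr_div_n e exprMn.
by rewrite mulrCA mulfK ?eqxx // mulf_neq0 // expf_neq0.
Qed.

End DeltaParity.

(** * From orbits of the group to orbits of the Weyl group *)

Section Converse.
Variables (F : finFieldType) (delta : F) (t : classical_type) (n l : nat).
Local Notation m := (msize t n).
Variable blk : 'I_m -> int.
Hypothesis blkN : forall i, blk (rev_ord i) = - blk i.
Hypothesis blk_le : forall i, `|blk i| <= l%:Z.
Hypothesis char2 : (2%:R : F) != 0.
Hypothesis delta0 : delta != 0.
Hypothesis delta_ns : forall x : F, x ^+ 2 != delta.
Implicit Types (D : {set 'I_m * 'I_m}) (a b : 'I_m * 'I_m) (w : 'S_m).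
Implicit Types phi psi : 'I_m * 'I_m -> F.

Lemma delta_rows_blk D phi (k : int) : is_typeC t -> basic_pair blk delta D phi ->
  (#|[set i in delta_rows delta D phi | blk i == k]| <= 1)%N.
Proof.
move=> tC [_ _]; rewrite tC => -[_ _ /(_ k) [_ le1]].
apply: leq_trans le1; rewrite -(card_imset _ (f := fun i : 'I_m => (i, rev_ord i))) =>
  [|i j [] //].
apply: subset_leq_card; apply/subsetP => _ /imsetP [i + ->].
rewrite !inE /= blkN => /andP [/andP [-> ->] /eqP ->].
by rewrite !eqxx.
Qed.

(** Once shorter symmetric arcs are settled, the parity on an arc is that of the number of deltas in
    its end block, and this number is 0 or 1. *)
Lemma delta_counts D phi psi (k : int) : is_typeC t -> basic_pair blk delta D phi ->
  basic_pair blk delta D psi ->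
  same_Ga_orbit blk (calX blk D phi) (calX blk D psi) ->
  #|[set i in delta_rows delta D phi | blk i == k]| =
  #|[set i in delta_rows delta D psi | blk i == k]|.
Proof.
move=> tC bp bq o; pose P := fun x : int => `|x| <= l%:Z.
have cE chi (Q : pred int) : count Q (map blk (enum (delta_rows delta D chi))) =
    #|[set i in delta_rows delta D chi | Q (blk i)]|.
  by rewrite count_map count_enum.
have all_P (A : {set 'I_m}) : all P (map blk (enum A)).
  by apply/allP => _ /mapP [i _ ->]; exact: blk_le.
rewrite -(cE phi (pred1 k)) -(cE psi (pred1 k)).
move: k; apply: (count_mem_rec (le := fun x y => arc l x (- x) y (- y))
  (d := fun x => `|cdist l x (- x)|%N) (P := P)) => //.
- by move=> x; exact: arc_refl.
- move=> x y bx b_y ar ne; apply: arc_lt ar _; rewrite ?normrN //.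
  by rewrite xpair_eqE (negPf ne).
move=> k c bk; rewrite !cE => e1 e2.
have := delta_parity blkN blk_le char2 delta0 delta_ns tC bp bq o bk.
rewrite e1 e2 !oddD => /addIb.
have := delta_rows_blk k tC bp; have := delta_rows_blk k tC bq.
by case: #|_| => [|[|?]] // _; case: #|_| => [|[|?]].
Qed.

(** [delta_counts] matches the classes with value delta; those with value 1 are their complement
    among the rooks of the common [D], and no other value occurs. *)
Lemma root_class_perm D phi psi : is_typeC t -> basic_pair blk delta D phi ->
  basic_pair blk delta D psi ->
  same_Ga_orbit blk (calX blk D phi) (calX blk D psi) ->
  perm_eq [seq root_class blk phi a | a <- enum D] [seq root_class blk psi a | a <- enum D].
Proof.
move=> tC bp bq o; apply: perm_eq_count_mem => -[[x y] [b v]].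
rewrite !count_map !count_enum /=.
pose S (chi : 'I_m * 'I_m -> F) v := [set a in D | root_class blk chi a == ((x, y), (b,
  v))].
rewrite -/(S phi v) -/(S psi v).
have Sd chi : basic_pair blk delta D chi -> #|S chi delta| =
    if b && (y == - x) then #|[set i in delta_rows delta D chi | blk i == x]| else 0%N.
  move=> [_ _]; rewrite tC => -[_ ad _]; case: ifP => [/andP [b1 /eqP yx]|nb].
    rewrite -[RHS](card_imset _ (f := fun i : 'I_m => (i, rev_ord i))) => [|i j [] //].
    apply: eq_card => a; rewrite inE; apply/idP/imsetP.
      move=> /andP [aD /eqP [e1 e2 e3 e4]]; rewrite b1 in e3.
      exists a.1; last by rewrite -(eqP e3); case: (a).
      by rewrite !inE -(eqP e3) -surjective_pairing aD e4 e1 !eqxx.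
    move=> [i + ->]; rewrite !inE => /andP [/andP [iD /eqP e1] /eqP e2].
    by rewrite iD /root_class /antidiag /= blkN e1 e2 yx b1 !eqxx.
  apply/eqP; rewrite cards_eq0; apply/eqP/setP => a; rewrite !inE.
  apply/negP => /andP [aD /eqP [e1 e2 e3 e4]]; move/negP: nb; apply.
  have aa := ad _ aD e4; rewrite -e3 aa -e1 -e2 (eqP aa) blkN eqxx //.
have Sde : #|S phi delta| = #|S psi delta|.
  by rewrite !Sd //; case: ifP => // _; exact: delta_counts.
have [->|vd] := eqVneq v delta; first exact: Sde.
have val chi : basic_pair blk delta D chi -> {in D, forall a, chi a = 1 \/ chi a = delta}.
  by move=> [_ _]; rewrite tC => -[].
have d1 : delta != 1 by apply: delta_neq1.
have [->|v1] := eqVneq v 1; last first.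
  have z chi : basic_pair blk delta D chi -> #|S chi v| = 0%N.
    move=> bc; apply/eqP; rewrite cards_eq0; apply/eqP/setP => a; rewrite !inE.
    apply/negP => /andP [aD /eqP [_ _ _ e4]]; case: (val _ bc _ aD); rewrite e4 => e.
      by rewrite e eqxx in v1.
    by rewrite e eqxx in vd.
  by rewrite !z.
have tot chi : basic_pair blk delta D chi -> (#|S chi 1%R| + #|S chi delta|)%N =
    #|[set a in D | [&& blk a.1 == x, blk a.2 == y & antidiag a == b]]|.
  move=> bc; rewrite -cardsUI (_ : S chi 1 :&: S chi delta = set0) ?cards0 ?addn0.
    apply: eq_card => a; rewrite !inE -andb_orr; case aD: (a \in D) => //=.
    rewrite /root_class !xpair_eqE; have := val _ bc _ aD.
    case: (_ == x); case: (_ == y); case: (_ == b) => //= -[->|->];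
    by rewrite ?eqxx ?orbT.
  apply/setP => a; rewrite !inE;
    apply/negP => /andP [/andP [_ /eqP [_ _ _ e1]] /andP [_ /eqP [_ _ _ e2]]].
  by move: d1; rewrite -e1 e2 eqxx.
by have := tot _ bp; rewrite -(tot _ bq) Sde => /addIn.
Qed.

Lemma Weyl_pairM w w' a : Weyl_pair (w * w')%g a = Weyl_pair w' (Weyl_pair w a).
Proof. by rewrite /Weyl_pair /= !permM rev_ordK. Qed.

Lemma antidiag_image w D phi D' phi' b : Weyl_act_rel w D phi D' phi' -> b \in D' ->
  antidiag b -> exists a, [/\ a \in D, antidiag a & b = Weyl_pair w a].
Proof.
move=> [_ DD _ _] bD ab; have : b \in D' :|: twins D' by rewrite in_setU bD.
rewrite DD => /imsetP [a aD e]; exists a; rewrite e antidiag_Weyl in ab.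
by rewrite -(antidiag_mem_twins _ ab).
Qed.

(** The Weyl element is a product: [w] matches the rooks by their blocks alone, and in type C a
    second one, [w2], permutes rooks of [D'] so as to match the labels. *)
Lemma orbit_Weyl D phi D' phi' :
  (forall i j, label i <= label j -> blk i <= blk j) ->
  basic_pair blk delta D phi -> basic_pair blk delta D' phi' ->
  same_Ga_orbit blk (calX blk D phi) (calX blk D' phi') ->
  same_Weyl_orbit blk D phi D' phi'.
Proof.
move=> blk_mono bp bp' o; have kp := key_perm blkN blk_le blk_mono char2 delta0 bp bp' o.
have rk := basic_rook bp; have rk' := basic_rook bp'.
have rD := basic_root bp; have rD' := basic_root bp'.
(* Condition (3) makes antidiagonality a function of the two blocks, so the counts of rooks by block
   pair determine the classes without labels. *)
have adE D1 phi1 : basic_pair blk delta D1 phi1 ->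
    {in D1, forall a, antidiag a = is_typeC t && (blk a.1 == - blk a.2)}.
  move=> bp1 a aD; case: (boolP (is_typeC t)) => tC /=; last first.
    apply: contraNF tC => ad; rewrite -(antidiag_root ad).
    by case/andP: (basic_root bp1 aD).
  apply/idP/eqP => [ad|e]; first by rewrite (eqP ad) blkN opprK.
  by case: bp1 => _ _; rewrite tC => -[_ _ /(_ (blk a.1)) [+ _]]; apply; rewrite // e opprK.
have rc D1 phi1 : basic_pair blk delta D1 phi1 ->
    [seq root_class blk (fun=> 1 : F) a | a <- enum D1] =
    [seq (x, (is_typeC t && (x.1 == - x.2), 1 : F)) | x <- map (key blk) (enum D1)].
  move=> bp1; rewrite -map_comp; apply/eq_in_map => a; rewrite mem_enum => aD.
  by rewrite /root_class (adE _ _ bp1).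
have same_cls : perm_eq [seq root_class blk (fun=> 1 : F) a | a <- enum D]
    [seq root_class blk (fun=> 1 : F) a | a <- enum D'].
  by rewrite (rc _ _ bp) (rc _ _ bp'); exact: perm_map.
have [w [wL wA]] := Weyl_from_classes blkN rk rk' (fun _ _ _ => erefl) same_cls.
case tC: (is_typeC t); last first.
  exists w; split=> //; case: wA => _ DD _ _; split=> // [a aD ad|b bD _].
    by move: ad; rewrite (adE _ _ bp) // tC.
  by case: bp' => _ _; rewrite tC; apply.
have wb i : blk (w i) = blk i by apply/eqP; move: wL; rewrite inE => /forallP.
(* The labels of [D] carried to [D'] along [w]. Since [w] preserves blocks, the result is a basic
   pair, and [Weyl_orbit] puts its element in the orbit of the given one; [psi] and [phi'] are now
   two labellings of [D']. *)
pose psi b := if antidiag b then phi (Weyl_pair (w^-1)%g b) else 1.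
have psiE a : antidiag a -> psi (Weyl_pair w a) = phi a.
  move=> ad; rewrite /psi antidiag_Weyl ad -Weyl_pairM mulgV /Weyl_pair !perm1 rev_ordK.
  by case: (a).
have bpC := bp; have bpC' := bp'; case: bpC => _ _; rewrite tC => -[v ad kd].
case: bpC' => _ _; rewrite tC => -[v' ad' kd'].
have d1 : delta != 1 by apply: delta_neq1.
have bq : basic_pair blk delta D' psi.
  split=> //; rewrite tC; split.
  - move=> b bD; case: (boolP (antidiag b)) => ab; last by left; rewrite /psi (negPf ab).
    by have [a [aD aa ->]] := antidiag_image wA bD ab; rewrite psiE //; exact: v.
  - move=> b bD; rewrite /psi; case: ifP => // _ e; by rewrite e eqxx in d1.
  move=> k; split; first by have [] := kd' k.
  have [_ le1] := kd k; apply: leq_trans le1.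
  rewrite -[leqRHS](card_imset _ (@Weyl_pair_inj t n w)); apply: subset_leq_card.
  apply/subsetP => b; rewrite inE => /and4P [bD b1 b2 pb].
  have ab : antidiag b.
    by move: pb; rewrite /psi; case: ifP => // _ e; rewrite eq_sym (negPf d1) in e.
  have [a [aD aa e]] := antidiag_image wA bD ab; rewrite e; apply: imset_f.
  rewrite inE aD -(psiE _ aa) -e pb; move: b1 b2;
    rewrite e /Weyl_pair /= blkN !wb blkN opprK.
  by move=> -> ->.
have wA2 : Weyl_act_rel w D phi D' psi.
  case: (wA) => _ DD _ _; split=> // [a _|b bD nb]; first exact: psiE.
  rewrite /psi; case: ifP => // ab; case/negP: nb.
  have [a [aD aa ->]] := antidiag_image wA bD ab; apply: imset_f.
  by rewrite inE aD aa.
have o1 := Weyl_orbit blkN blk_le blk_mono char2 wL rD rk (basic_neq0 delta0 bp)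
  (basic_neq0 delta0 bq) wA2.
have aX := ua_alg (calX_ua blkN phi rD).
have o2 : same_Ga_orbit blk (calX blk D' psi) (calX blk D' phi').
  apply: (same_orbit_trans blkN _ (same_orbit_sym blkN aX o1) o).
  exact: ua_alg (calX_ua blkN psi rD').
have one b : b \in D' -> ~~ antidiag b -> phi' b = 1.
  by move=> bD nb; case: (v' _ bD) => // /(ad' _ bD); rewrite (negPf nb).
have [w2 [wL2 wA3]] := Weyl_from_classes blkN rk' rk' one (root_class_perm tC bq bp' o2).
exists (w * w2)%g; split.
  rewrite inE; apply/forallP => i; rewrite permM; move: wL2;
    rewrite inE => /forallP /(_ (w i)).
  by rewrite wb.
have [_ DD2 p2 _] := wA2; have [_ DD3 p3 _] := wA3.
have im (A : {set 'I_m * 'I_m}) :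
    [set Weyl_pair (w * w2)%g a | a in A] = [set Weyl_pair w2 b | b in [set Weyl_pair w a
      | a in A]].
  by rewrite -imset_comp; apply: eq_imset => a; rewrite /= Weyl_pairM.
split=> //.
- by rewrite im -DD2.
- move=> a aD aa; rewrite Weyl_pairM p3 ?p2 ?antidiag_Weyl //.
  have := antidiag_mem_twins D' (a := Weyl_pair w a);
    rewrite antidiag_Weyl aa => /(_ isT) <-.
  by rewrite DD2 imset_f // in_setU aD.
- move=> b bD nb; apply: one => //; apply: contra nb => ab.
  have [b1 [b1D ab1 ->]] := antidiag_image wA3 bD ab.
  have [a [aD aa ->]] := antidiag_image wA2 b1D ab1.
  by rewrite -Weyl_pairM; apply: imset_f; rewrite inE aD aa.
Qed.

End Converse.

Theorem theorem4p6 (F : finFieldType) (delta : F) (t : classical_type)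
    (n l : nat) (blk : 'I_(msize t n) -> int)
    (char_F : 2%N \notin [pchar F])
    (delta_neq0 : delta != 0)
    (delta_nonsquare : forall x : F, x ^+ 2 != delta)
    (blk_segments : symmetric_segments l blk) :
  (forall X : 'M[F]_(msize t n) * 'M[F]_(msize t n),
     in_ua blk X ->
     exists (D : {set 'I_(msize t n) * 'I_(msize t n)})
            (phi : 'I_(msize t n) * 'I_(msize t n) -> F),
       basic_pair blk delta D phi /\ same_Ga_orbit blk X (calX blk D phi)) /\
  (forall (D D' : {set 'I_(msize t n) * 'I_(msize t n)})
          (phi phi' : 'I_(msize t n) * 'I_(msize t n) -> F),
     basic_pair blk delta D phi -> basic_pair blk delta D' phi' ->
     (same_Ga_orbit blk (calX blk D phi) (calX blk D' phi') <->
      same_Weyl_orbit blk D phi D' phi')).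
Proof.
have [blk_mono blkN blk_le _] := blk_segments.
have char2 : (2%:R : F) != 0 by move: char_F; rewrite inE.
split=> [X uX|D D' phi phi' bp bp'].
  exact: (basic_exists blkN blk_le blk_mono char2 delta_neq0 delta_nonsquare uX).
split=> [o|[w [wL wA]]].
  exact: (orbit_Weyl blkN blk_le char2 delta_neq0 delta_nonsquare blk_mono bp bp' o).
apply: (Weyl_orbit blkN blk_le blk_mono char2 wL _ _ _ _ wA).
- exact: basic_root bp.
- exact: basic_rook bp.
- exact: (basic_neq0 delta_neq0 bp).
- exact: (basic_neq0 delta_neq0 bp').
Qed.
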